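(* Let $\mathcal{U}$ be a (nonempty) proper geodesic $\mathrm{CAT}(0)$ space and $m$ a non-negative integer. The following statements are equivalent: (a) $\mathrm{TopDim}\,\mathcal{U}\ge m$. (b) There is an array of $m+1$ open balls $B_i=\mathrm{B}(a_i,r_i)$, $i=0,\ldots,m$, in $\mathcal{U}$ such that $$\bigcap_i B_i=\emptyset,\quad\text{but}\quad \bigcap_{i\ne j}B_i\ne\emptyset\quad\text{for each } j.$$ (c) There is a $C^{1/2}$-embedding $\Phi$ of a nonempty open set of $\mathbb{R}^m$ into $\mathcal{U}$; that is, $\Phi$ is bi-Hölder with exponent $\tfrac12$.
   Context: A geodesic is a distance-preserving map from a real interval; a metric space is geodesic if any two of its points are joined by a geodesic, and proper if all closed bounded sets are compact. The open ball is $\mathrm{B}(a,r)=\{x:|a-x|<r\}$, $r\ge0$. An intersection over the empty index set is the whole space $\mathcal{U}$. $\mathrm{CAT}(0)$: a metric space $\mathcal{X}$ is $\mathrm{CAT}(0)$ if every quadruple $p,q,x,y\in\mathcal{X}$ satisfies the following. Let $[\tilde p\tilde x\tilde y]$ and $[\tilde q\tilde x\tilde y]$ be triangles in the Euclidean plane with common side $[\tilde x\tilde y]$ and with the same side lengths as the triples $(p,x,y)$ and $(q,x,y)$. Then $|p-q|_{\mathcal X}\le|\tilde p-\tilde z|+|\tilde z-\tilde q|$ for every $\tilde z\in[\tilde x\tilde y]$. Topological dimension: $\mathrm{TopDim}\,\mathcal{X}$ is the minimal non-negative integer $n$ such that every open cover of $\mathcal{X}$ has a locally finite open refinement of order at most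 $n$ (no $n+2$ distinct elements of the refinement have a common point); it is $\infty$ if no such $n$ exists. A map $\Phi$ is bi-Hölder with exponent $\tfrac12$ if it is injective and both $\Phi$ and its inverse $\Phi^{-1}$ (defined on the image) are Hölder continuous with exponent $\tfrac12$. *)

(* Defs.v *)
From mathcomp Require Import all_boot all_order all_algebra.
From mathcomp Require Import all_classical all_reals all_analysis.

Set Implicit Arguments.
Unset Strict Implicit.
Unset Printing Implicit Defensive.

Import Order.TTheory GRing.Theory Num.Theory.
Import numFieldNormedType.Exports.

Local Open Scope classical_set_scope.
Local Open Scope ring_scope.

Section Metric.
Context {R : realType}.

(* The library norm on ['rV[R]_n] is the sup norm, hence a separate distance;
   it induces the library topology of ['rV[R]_n]. *)
Definition eucl_dist (n : nat) (x y : 'rV[R]_n) : R :=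
  Num.sqrt (\sum_(i < n) (x ord0 i - y ord0 i) ^+ 2).

Definition eucl_segment (n : nat) (x y : 'rV[R]_n) : set 'rV[R]_n :=
  [set z | exists2 t : R, 0 <= t <= 1 & z = (1 - t) *: x + t *: y].

Definition geodesic (U : metricType R) (I : interval R) (g : R -> U) : Prop :=
  {in I &, forall s t, mdist (g s) (g t) = `|s - t|}.

Definition geodesic_space (U : metricType R) : Prop :=
  forall x y : U, exists (a b : R) (g : R -> U),
    [/\ a <= b, geodesic `[a, b] g, g a = x & g b = y].

Definition metric_bounded (U : metricType R) (A : set U) : Prop :=
  exists M : R, forall x y, A x -> A y -> mdist x y <= M.

Definition proper_space (U : metricType R) : Prop :=
  forall A : set U, closed A -> metric_bounded A -> compact A.

(* [px], [qx], [x'], [y'] are the vertices of two plane triangles sharing the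
   side [x' y'].  The triangles may be degenerate, and may lie on the same side
   or on opposite sides of their common side: reflecting one of them in it
   changes no distance to a point of it. *)
Definition CAT0 (U : metricType R) : Prop :=
  forall (p q x y : U) (p' q' x' y' : 'rV[R]_2),
    eucl_dist p' x' = mdist p x -> eucl_dist p' y' = mdist p y ->
    eucl_dist q' x' = mdist q x -> eucl_dist q' y' = mdist q y ->
    eucl_dist x' y' = mdist x y ->
    forall z', eucl_segment x' y' z' ->
      mdist p q <= eucl_dist p' z' + eucl_dist z' q'.

Definition hoelder_on (X Y : Type) (dX : X -> X -> R) (dY : Y -> Y -> R)
    (alpha : R) (A : set X) (f : X -> Y) : Prop :=
  exists C : R, forall x y, A x -> A y ->
    dY (f x) (f y) <= C * dX x y `^ alpha.

(* Only the values of [f] on [A], and those of its inverse [g] on [f @` A],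
   are constrained. *)
Definition bihoelder_on (X Y : Type) (dX : X -> X -> R) (dY : Y -> Y -> R)
    (alpha : R) (A : set X) (f : X -> Y) : Prop :=
  [/\ set_inj A f,
      hoelder_on dX dY alpha A f
    & exists2 g : Y -> X, (forall x, A x -> g (f x) = x)
                        & hoelder_on dY dX alpha (f @` A) g].

End Metric.

Section TopologicalDimension.
Context {T : topologicalType}.
Implicit Types C V : set (set T).

Definition open_cover C : Prop :=
  (forall A, C A -> open A) /\ \bigcup_(A in C) A = [set: T].

Definition refines V C : Prop :=
  forall B, V B -> exists2 A, C A & B `<=` A.

Definition locally_finite V : Prop :=
  forall x : T, exists2 N, nbhs x N & finite_set [set B | V B /\ B `&` N !=set0].

Definition order_at_most (n : nat) V : Prop :=
  forall F : 'I_n.+2 -> set T, injective F -> (forall i, V (F i)) ->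
    \bigcap_i F i = set0.

Definition covering_dim_at_most (n : nat) : Prop :=
  forall C, open_cover C ->
    exists V, [/\ open_cover V, refines V C, locally_finite V
                & order_at_most n V].

End TopologicalDimension.

Definition topdim (T : topologicalType) : \bar int :=
  match pselect (exists n, `[< @covering_dim_at_most T n >]) with
  | left dimT => (Posz (ex_minn dimT))%:E
  | right _ => +oo%E
  end.

(* Main.v *)
Require Import Defs.
From HB Require Import structures.
From mathcomp Require Import all_boot all_order all_algebra finmap.
From mathcomp Require Import all_classical all_reals all_analysis.
From mathcomp Require Import lra ring zify.

(* For a family of points [a_i] and weights [v_i] the function
   [max_i (d(a_i, _)^2 - v_i)] is strongly convex, so it has a unique minimum point, which is
   a 1/2-Hoelder function of [v].

   (b) => (c): for the balls of (b), all the functions [d(a_i, _)^2 - r_i^2 - v_i] are active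
   at the minimum point as long as [v] is small, hence the minimum point determines [v] up to
   a common constant, and the map sending [v] to it is the embedding.

   (c) => (a): Lebesgue's covering argument in a cube, from Kuhn's cubical form of Sperner's
   lemma.

   (a) => (b): if (b) fails for [m], it fails for all larger numbers (by Kuhn's lemma again),
   so every family of balls with empty intersection has a subfamily of at most [m] balls with
   empty intersection.  Therefore the minimum point lies in the web of at most [m] of the
   [a_i], the set of points at which no competitor is closer to all of these.  A web of [m]
   points is parametrized by the [m - 1] differences of the squared distances, so its dimension
   is at most [m - 1].  With the weights [v_i = d(a_i, p)^2], for a fine net [a_i], the minimum
   point is close to [p], and covers of the webs pull back to covers of the space. *)

Set Implicit Arguments.
Unset Strict Implicit.
Unset Printing Implicit Defensive.

Import Order.TTheory GRing.Theory Num.Theory.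
Import numFieldNormedType.Exports.

Local Open Scope classical_set_scope.
Local Open Scope ring_scope.

(** * Kuhn's cubical Sperner lemma *)

Section Kuhn.
Variables m N : nat.
Local Open Scope nat_scope.
Local Open Scope bool_scope.
Local Notation grid := {ffun 'I_m -> 'I_N.+1}.

(* At the far face, where [x i = N], the step wraps around to [0]. *)
Definition grid_step (x : grid) (i : 'I_m) : grid :=
  [ffun j => if j == i then inord (x j).+1 else x j].

Lemma grid_stepC x i j : grid_step (grid_step x i) j = grid_step (grid_step x j) i.
Proof.
apply/ffunP => k; rewrite !ffunE.
by case: (k =P j) => [->|]; case: (_ =P i) => // ->.
Qed.

(* Sum modulo 2 of [phi] over the paths [x, x + e_i1, x + e_i1 + e_i2, ...] for all
   enumerations [i1, i2, ...] of [I]: the simplices of the Kuhn triangulation of a cube. *)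
Fixpoint kuhn_sum n (I : {set 'I_m}) x (phi : seq grid -> bool) : bool :=
  if n is n'.+1 then
    \big[addb/false]_(i in I) kuhn_sum n' (I :\ i)%SET (grid_step x i) (phi \o cons x)
  else phi [:: x].

Lemma kuhn_sumS n (I : {set 'I_m}) x phi : kuhn_sum n.+1 I x phi =
  \big[addb/false]_(i in I) kuhn_sum n (I :\ i)%SET (grid_step x i) (phi \o cons x).
Proof. by []. Qed.

(** The simplicial coboundary modulo 2: [phi] is summed over the lists obtained from [l] by omitting
    one vertex. *)
Fixpoint boundary (phi : seq grid -> bool) (l : seq grid) : bool :=
  if l is y :: l' then phi l' (+) boundary (phi \o cons y) l' else false.

Arguments kuhn_sum : simpl never.

Lemma eq_kuhn_sum n I x phi psi : phi =1 psi ->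
  kuhn_sum n I x phi = kuhn_sum n I x psi.
Proof.
elim: n I x phi psi => [|n IH] I x phi psi e; first exact: e.
by rewrite !kuhn_sumS; apply: eq_bigr => i _; apply: IH => l /=; exact: e.
Qed.

Lemma kuhn_sumD n I x phi psi :
  kuhn_sum n I x (fun l => phi l (+) psi l) = kuhn_sum n I x phi (+) kuhn_sum n I x psi.
Proof.
elim: n I x phi psi => [|n IH] I x phi psi //.
rewrite !kuhn_sumS -big_split; apply: eq_bigr => i _ /=.
by rewrite -IH; exact: eq_kuhn_sum.
Qed.

(** The terms at [(i, j)] and [(j, i)] cancel modulo 2. The proof first keeps the diagonal, so as to
    induct on a list. *)
Lemma big_addb_sym (I : {set 'I_m}) (F : 'I_m -> 'I_m -> bool) :
  (forall i j, F i j = F j i) ->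
  \big[addb/false]_(i in I) \big[addb/false]_(j in (I :\ i)%SET) F i j = false.
Proof.
move=> Fs.
have aux (s : seq 'I_m) : \big[addb/false]_(i <- s) \big[addb/false]_(j <- s) F i j =
    \big[addb/false]_(i <- s) F i i.
  elim: s => [|a s IH]; first by rewrite !big_nil.
  rewrite !big_cons; under [X in _ (+) X]eq_bigr do rewrite big_cons.
  have E : \big[addb/false]_(i <- s) F i a = \big[addb/false]_(i <- s) F a i.
    by apply: eq_bigr => i _; rewrite Fs.
  rewrite big_split /= IH E.
  by rewrite -addbA addKb.
have e i : i \in I -> \big[addb/false]_(j in (I :\ i)%SET) F i j =
    F i i (+) \big[addb/false]_(j in I) F i j.
  move=> iI; rewrite [in RHS](bigD1 i)//= addKb.
  by apply: eq_bigl => j; rewrite !inE andbC.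
rewrite (eq_bigr _ e) big_split /=.
rewrite -[X in _ (+) X]big_enum.
under [X in _ (+) X]eq_bigr do rewrite -big_enum.
by rewrite aux big_enum addbb.
Qed.

(* The faces obtained by omitting an inner vertex of a path cancel in pairs. *)
Lemma kuhn_sum_boundary n (I : {set 'I_m}) x phi :
  kuhn_sum n.+1 I x (boundary phi) =
  \big[addb/false]_(i in I) (kuhn_sum n (I :\ i)%SET (grid_step x i) phi (+)
                             kuhn_sum n (I :\ i)%SET x phi).
Proof.
elim: n I x phi => [|n IH] I x phi.
  by apply: eq_bigr => i _; rewrite /kuhn_sum /= addbF.
transitivity (\big[addb/false]_(i in I) (kuhn_sum n.+1 (I :\ i)%SET (grid_step x i) phi (+)
   kuhn_sum n.+1 (I :\ i)%SET (grid_step x i) (boundary (phi \o cons x)))).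
  rewrite kuhn_sumS; apply: eq_bigr => i _; rewrite -kuhn_sumD.
  exact: eq_kuhn_sum.
rewrite !big_split /=; congr (_ (+) _).
under eq_bigr do rewrite IH big_split /=.
(* The terms in which both steps [i] and [j] are made are symmetric in [i] and [j]; the others,
   summed over [i] first, give the near face in direction [j]. *)
rewrite big_split /= big_addb_sym; last first.
  by move=> i j; rewrite grid_stepC; congr kuhn_sum; apply/setP => k; rewrite !inE andbCA.
rewrite /= (exchange_big_dep (mem I)) /=; last by move=> i j _; rewrite inE => /andP[].
apply: eq_bigr => j jI; apply: eq_big => [i|i _].
  by rewrite !inE jI andbT andbC eq_sym.
by congr kuhn_sum; apply/setP => k; rewrite !inE andbCA.
Qed.

Lemma kuhn_sum_path n (I : {set 'I_m}) (x : grid) phi : kuhn_sum n I x phi ->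
  exists l, [/\ phi l, size l = n.+1 &
    forall y : grid, y \in l -> forall i, y i = x i \/ (i \in I /\ y i = inord (x i).+1)].
Proof.
elim: n I x phi => [|n IH] I x phi; rewrite ?kuhn_sumS.
  by move=> p; exists [:: x]; split=> // y; rewrite inE => /eqP -> i; left.
move=> H; have /existsP[i /andP[iI /IH[l [pl sl Hl]]]] : [exists i, (i \in I) &&
    kuhn_sum n (I :\ i)%SET (grid_step x i) (phi \o cons x)].
  apply: contraT; rewrite negb_exists => /forallP H'.
  by move: H; rewrite big1// => i iI; move: (H' i); rewrite iI => /negbTE.
exists (x :: l); split=> //=; first by rewrite sl.
move=> y; rewrite inE => /orP[/eqP->|yl j]; first by left.
case: (Hl y yl j) => [->|[]].
  by rewrite ffunE; case: eqP => [->|_]; [right|left].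
rewrite in_setD1 ffunE => /andP[/negbTE -> jI] ->; by right.
Qed.

Lemma kuhn_sum0 n (I : {set 'I_m}) (x : grid) phi :
  (forall l, size l = n.+1 ->
    (forall y : grid, y \in l -> forall i, y i = x i \/ (i \in I /\ y i = inord (x i).+1)) ->
    ~~ phi l) -> kuhn_sum n I x phi = false.
Proof.
move=> H; apply: contraTF isT => /kuhn_sum_path [l [pl sl Hl]].
by have := H l sl Hl; rewrite pl.
Qed.

(** Kuhn's boundary conditions. By [c_near], only colours up to [k] occur where coordinate [k]
    vanishes, which permits induction over faces. *)
Variable c : grid -> nat.
Hypothesis c_le : forall x, c x <= m.
Hypothesis c_near : forall (x : grid) i, x i = 0 :> nat -> c x <= i.
Hypothesis c_far : forall (x : grid) i, x i = N :> nat -> c x != i.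
Hypothesis N_gt0 : 0 < N.

Definition rainbow k (l : seq grid) : bool := perm_eq (map c l) (iota 0 k).

(** Sperner's count: a list with all colours [0 .. k + 1] has exactly one facet coloured [0 .. k];
    any other list has two such facets (a colour is repeated) or none. *)
Lemma boundary_rainbow k l : size l = k.+2 -> all (fun x => c x <= k.+1) l ->
  boundary (rainbow k.+1) l = rainbow k.+2 l.
Proof.
move=> sl cl.
have bdE (s : seq grid) (phi : seq grid -> bool) (r : seq grid) :
    (forall t, phi t = perm_eq (map c (r ++ t)) (iota 0 k.+1)) ->
    boundary phi s = \big[addb/false]_(v <- s) perm_eq (map c (r ++ s)) (c v :: iota 0 k.+1).
  elim: s phi r => [|y s IH] phi r H /=; first by rewrite big_nil.
  rewrite big_cons; congr (_ (+) _).
    rewrite H !map_cat map_cons -cat1s (perm_catCA (map c r) [:: c y]).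
    by rewrite perm_cons.
  rewrite (IH _ (r ++ [:: y])); first by rewrite -catA.
  by move=> t /=; rewrite H -catA.
rewrite (bdE l _ [::]); last by [].
rewrite /= /rainbow.
set L := map c l.
transitivity (\big[addb/false]_(v <- L) perm_eq L (v :: iota 0 k.+1)).
  by rewrite big_map.
have cL : all (fun v => v <= k.+1) L by rewrite all_map.
clearbody L; clear -cL sl.
have E2 : iota 0 k.+2 = rcons (iota 0 k.+1) k.+1 by rewrite -[k.+2]addn1 iotaD cats1.
case: (boolP (has (fun v => perm_eq L (v :: iota 0 k.+1)) L)) => [/hasP[v vL pv]|/hasPn H].
  rewrite (perm_big _ pv) big_cons pv.
  have E w : perm_eq L (w :: iota 0 k.+1) = (w == v).
    rewrite (permPl pv); apply/idP/eqP => [|->//] p; apply/eqP.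
    move/allP/(_ v): p; rewrite mem_cat mem_head => /(_ isT) /=.
    by rewrite !eqxx (eq_sym w); case: (v == w) => //=; lia.
  under eq_bigr do rewrite E.
  have B (s : seq nat) : \big[addb/false]_(j <- s) (j == v) = odd (count_mem v s).
    by elim: s => [|w s IH]; rewrite ?big_nil// big_cons IH /= oddD; case: (w == v).
  rewrite B count_uniq_mem ?iota_uniq// mem_iota add0n leq0n (permPl pv).
  have /(_ _ vL) := allP cL; rewrite leq_eqVlt => /orP[/eqP vk|vk].
    by rewrite vk ltnn E2 perm_sym perm_rcons perm_refl.
  rewrite vk; apply/esym/negbTE/negP => p.
  have : uniq (v :: iota 0 k.+1).
    by rewrite (perm_uniq p) iota_uniq.
  by rewrite cons_uniq mem_iota add0n vk.
rewrite big1_seq; last by move=> v /= /H /negbTE.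
apply/esym/negbTE/negP => p; have /negP[] : ~~ perm_eq L (k.+1 :: iota 0 k.+1).
  by apply: H; rewrite (perm_mem p) mem_iota add0n ltnS leqnn.
by rewrite (permPl p) E2 perm_rcons perm_refl.
Qed.

(** The least corners of the unit cubes tiling the face on which the coordinates from [k] on
    vanish. *)
Definition kuhn_box k : pred grid :=
  fun x => [forall i : 'I_m, if i < k then x i < N else x i == 0 :> nat].

Definition rainbow_parity k : bool :=
  \big[addb/false]_(x | kuhn_box k x) kuhn_sum k [set i : 'I_m | i < k]%SET x (rainbow k.+1).

Definition grid_stepV (x : grid) (i : 'I_m) : grid :=
  [ffun j => if j == i then inord (x j).-1 else x j].

(** The sum telescopes in direction [i], and [F] vanishes at the far end. *)
Lemma big_grid_step (P : pred grid) i (F : grid -> bool) :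
  (forall x : grid, x i < N -> P (grid_step x i) = P x) ->
  (forall x : grid, x i = N :> nat -> F x = false) ->
  \big[addb/false]_(x : grid | P x && (x i < N)) (F (grid_step x i) (+) F x) =
  \big[addb/false]_(x : grid | P x && (x i == 0 :> nat)) F x.
Proof.
move=> HP HF; rewrite big_split /=.
have -> : \big[addb/false]_(x : grid | P x && (x i < N)) F (grid_step x i) =
          \big[addb/false]_(x : grid | P x && (0 < x i)) F x.
  rewrite [RHS](reindex_onto (grid_step^~ i) (grid_stepV^~ i)) /=; last first.
    move=> x /andP[_ x0]; apply/ffunP => j; rewrite !ffunE; case: eqP => // ->.
    have p : (inord (x i).-1 : 'I_N.+1) = (x i).-1 :> nat.
      by rewrite inordK// (leq_ltn_trans (leq_pred _)).
    by rewrite p prednK// inord_val.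
  apply: eq_bigl => x; have [xN|] := ltnP (x i) N.
    rewrite HP// andbT; have xi : grid_step x i i = (x i).+1 :> nat.
      by rewrite ffunE eqxx inordK.
    rewrite xi /= andbT; case: (P x) => //=; apply/esym/eqP/ffunP => j; rewrite !ffunE.
    by case: eqP => // ->; rewrite inordK ?ltnS//= inord_val.
  rewrite leq_eqVlt ltnNge -ltnS ltn_ord orbF => /eqP xN; rewrite andbF.
  apply/esym/negbTE; rewrite negb_and; apply/orP; left; rewrite negb_and; apply/orP; right.
  by rewrite ffunE eqxx -xN /inord /insubd insubF ?ltnn//.
rewrite (bigID (fun x : grid => x i < N) (fun x => P x && (0 < x i))) /=.
rewrite [X in _ (+) X](bigID (fun x : grid => 0 < x i)) /=.
rewrite [X in (_ (+) X) (+) _]big1 ?addbF; last first.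
  move=> x /andP[_ xN]; apply: HF; apply/eqP; rewrite eqn_leq [N <= _]leqNgt xN andbT.
  by rewrite -ltnS ltn_ord.
rewrite addbA.
rewrite (eq_bigl (fun x => P x && (x i < N) && (0 < x i))); last by move=> x; rewrite andbAC.
rewrite addbb /=; apply: eq_bigl => x; rewrite lt0n negbK.
by case: eqP => [->|]; rewrite ?andbT ?andbF// N_gt0 andbT.
Qed.

(** Count facets coloured [0 .. k]. Those between adjacent cubes cancel; the far face in direction
    [i] lacks colour [i], and the near one for [i < k] lacks colour [k]. Only the near face in
    direction [k] remains. *)
Lemma rainbow_parityS k : k < m -> rainbow_parity k.+1 = rainbow_parity k.
Proof.
move=> km; rewrite /rainbow_parity.
set I := fun k => [set i : 'I_m | i < k]%SET.
transitivity (\big[addb/false]_(x | kuhn_box k.+1 x)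
    kuhn_sum k.+1 (I k.+1) x (boundary (rainbow k.+1))).
  apply: eq_bigr => x /forallP xb.
  apply/eqP; rewrite -[_ == _]negbK negb_eqb -kuhn_sumD kuhn_sum0// => l sl Hl.
  rewrite boundary_rainbow ?addbb//; apply/allP => y yl.
  have [km1|mk] := ltnP k.+1 m; last exact: leq_trans (c_le y) mk.
  apply: (@c_near y (Ordinal km1)); have := xb (Ordinal km1); rewrite ltnn => /eqP x0.
  by case: (Hl y yl (Ordinal km1)) => [->//|[]]; rewrite inE ltnn.
under eq_bigr do rewrite kuhn_sum_boundary.
rewrite (exchange_big_dep (mem (I k.+1))) //=.
have far (i : 'I_m) (x : grid) : i \in I k.+1 -> x i = N :> nat ->
    kuhn_sum k (I k.+1 :\ i)%SET x (rainbow k.+1) = false.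
  rewrite inE => ik xN; apply: kuhn_sum0 => l sl Hl; apply/negP => /perm_mem/(_ (i : nat)).
  rewrite mem_iota add0n ik => /mapP[y yl /esym/eqP]; apply/negP; apply: c_far.
  by case: (Hl y yl i) => [->//|[]]; rewrite !inE eqxx.
have near (i : 'I_m) (x : grid) : i < k -> x i = 0 :> nat ->
    kuhn_sum k (I k.+1 :\ i)%SET x (rainbow k.+1) = false.
  move=> ik x0; apply: kuhn_sum0 => l sl Hl; apply/negP => /perm_mem/(_ k).
  rewrite mem_iota add0n ltnSn => /mapP[y yl]; apply/eqP; rewrite gtn_eqF//.
  rewrite (leq_ltn_trans _ ik)//; apply: c_near.
  by case: (Hl y yl i) => [->//|[]]; rewrite !inE eqxx.
pose P (i : 'I_m) := fun x : grid =>
  [forall j : 'I_m, (j != i) ==> if j < k.+1 then x j < N else x j == 0 :> nat].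
have boxE (i : 'I_m) x : i \in I k.+1 -> kuhn_box k.+1 x = P i x && (x i < N).
  rewrite inE => ik; apply/forallP/andP => [H|[/forallP H xi] j].
    by split; [apply/forallP => j; apply/implyP => _|have := H i; rewrite ik].
  by have := H j; case: eqVneq => // -> _; rewrite ik.
transitivity (\big[addb/false]_(i in I k.+1)
    \big[addb/false]_(x : grid | P i x && (x i == 0 :> nat))
      kuhn_sum k (I k.+1 :\ i)%SET x (rainbow k.+1)).
  apply: eq_bigr => i iI; rewrite -big_grid_step; last by move=> x; exact: far.
    by apply: eq_bigl => x; rewrite iI andbT (boxE i).
  move=> x xi; apply: eq_forallb => j.
  by have [//|ji] := eqVneq j i; rewrite ffunE (negbTE ji).
have kI : Ordinal km \in I k.+1 by rewrite inE ltnSn.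
rewrite (bigD1 (Ordinal km))//= [X in _ (+) X]big1 ?addbF; last first.
  move=> i; rewrite inE => /andP[ik1 ik]; rewrite big1// => x /andP[_ /eqP]; apply: near.
  by rewrite ltn_neqAle -ltnS ik1 andbT; apply: contra ik => /eqP e; apply/eqP/val_inj.
apply: eq_big => [x|x _].
  apply/andP/forallP => [[/forallP H x0] i|H]; last first.
    split; last by have := H (Ordinal km); rewrite ltnn.
    apply/forallP => i; apply/implyP => ik; have := H i.
    rewrite ltnS; case: (ltngtP i k) => // e; case/negP: ik; apply/eqP; exact: ord_inj.
  have := H i; case: (eqVneq i (Ordinal km)) => [-> _|ik]; first by rewrite ltnn.
  by rewrite ltnS; case: (ltngtP i k) => // e; case/negP: ik; apply/eqP; exact: ord_inj.
congr kuhn_sum; apply/setP => i; rewrite !inE ltnS [in RHS]ltn_neqAle.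
by congr (_ && _).
Qed.

Lemma rainbow_parity0 : rainbow_parity 0.
Proof.
have box0 : kuhn_box 0 [ffun=> ord0] by apply/forallP => i; rewrite ffunE.
rewrite /rainbow_parity (bigD1 [ffun=> ord0])//= big1 ?addbF; last first.
  move=> x /andP[/forallP xb /eqP[]]; apply/ffunP => i; rewrite ffunE.
  by apply/val_inj/eqP; exact: xb.
rewrite /kuhn_sum /= /rainbow /=.
suff -> : c [ffun=> ord0] = 0 by [].
apply/eqP; rewrite -leqn0; have [m0|m0] := posnP m; first by rewrite -m0.
by apply: (@c_near _ (Ordinal m0)); rewrite ffunE.
Qed.

(** The parity is odd in dimension 0, hence in dimension [m]; the vertices of a Kuhn simplex lie in
    one unit cube. *)
Lemma kuhn_rainbow : exists y : 'I_m.+1 -> grid,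
  (forall j, c (y j) = j) /\ forall j j' i, y j i <= (y j' i).+1.
Proof.
have : rainbow_parity m.
  suff: forall k, k <= m -> rainbow_parity k by apply.
  by elim=> [_|k IH km]; rewrite ?rainbow_parity0// rainbow_parityS// IH// ltnW.
rewrite /rainbow_parity => H.
have /existsP[x /andP[/forallP xb /kuhn_sum_path[l [/perm_mem pl sl Hl]]]] :
    [exists x, kuhn_box m x && kuhn_sum m [set i : 'I_m | i < m]%SET x (rainbow m.+1)].
  apply: contraLR H; rewrite negb_exists => /forallP H; rewrite big1// => x xb.
  by have := H x; rewrite xb => /negbTE.
have sel (j : 'I_m.+1) : exists y, y \in l /\ c y = j.
  have := pl j; rewrite mem_iota add0n ltn_ord => /mapP[y yl ->]; by exists y.
have {}Hl y i : y \in l -> x i <= y i <= (x i).+1.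
  move=> /Hl/(_ i) [->|[_ ->]]; first by rewrite leqnn leqW.
  by rewrite inordK ?leqnn ?leqnSn//; have := xb i; rewrite ltn_ord.
have [y Hy] := choice sel; exists y; split=> [j|j j' i]; first by have [] := Hy j.
have /andP[_ h1] := Hl _ i (Hy j).1; have /andP[h2 _] := Hl _ i (Hy j').1.
exact: leq_trans h1 _.
Qed.

End Kuhn.

(** * Minimax points and webs *)

Section MinimaxPoints.
Context {R : realType} {U : metricType R}.
Local Notation d := (@mdist R U).
Implicit Types x y z p : U.

Lemma mdist_continuous x : continuous (d x).
Proof.
move=> y; apply/cvgrPdist_lt => e e0; near=> z.
have : ball y e z by near: z; exact: nbhsx_ballx.
rewrite ballEmdist /= => yz; have := metric_triangle x y z; have := metric_triangle x z y.
by rewrite (metric_sym z y) ltr_norml => h1 h2; apply/andP; split; lra.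
Unshelve. all: by end_near. Qed.

Lemma ballE x (r : R) y : ball x r y <-> d x y < r.
Proof. by rewrite ballEmdist. Qed.

(** The Bruhat-Tits inequality at every ratio [t]. It is all that the later arguments take from the
    CAT(0) condition. *)
Definition convex_distance :=
  forall x y (t : R), 0 <= t <= 1 -> exists c, forall p,
    d p c ^+ 2 <= (1 - t) * d p x ^+ 2 + t * d p y ^+ 2 - t * (1 - t) * d x y ^+ 2.

Definition point2 (u v : R) : 'rV[R]_2 := \row_i (if i == ord0 then u else v).

Lemma eucl_dist_point2 u v u' v' :
  eucl_dist (point2 u v) (point2 u' v') = Num.sqrt ((u - u') ^+ 2 + (v - v') ^+ 2).
Proof. by rewrite /eucl_dist !big_ord_recl big_ord0 addr0 !mxE. Qed.

(* The comparison triangle of [q] is degenerate for [q] on the geodesic [x y], so that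
   the comparison inequality becomes Stewart's identity in the plane. *)
Lemma CAT0_convex_distance : geodesic_space U -> CAT0 U -> convex_distance.
Proof.
move=> geo cat x y t /andP[t0 t1]; have [a [b [g [ab gg ga gb]]]] := geo x y.
have I0 s : 0 <= s <= 1 -> a + s * (b - a) \in `[a, b].
  by move=> /andP[s0 s1]; rewrite in_itv /=; apply/andP; split; nra.
have Ia : a \in `[a, b] by rewrite in_itv /= lexx.
have Ib : b \in `[a, b] by rewrite in_itv /= lexx ab.
have It : a + t * (b - a) \in `[a, b] by apply: I0; rewrite t0.
exists (g (a + t * (b - a))) => p; set c := g _.
have xy : d x y = b - a by rewrite -ga -gb gg// distrC ger0_norm// subr_ge0.
have cx : d c x = t * d x y.
  rewrite xy -[x in d c x]ga gg// ger0_norm; first by ring.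
  have -> : a + t * (b - a) - a = t * (b - a) by ring.
  by rewrite mulr_ge0// subr_ge0.
have cy : d c y = (1 - t) * d x y.
  rewrite xy -gb gg// distrC ger0_norm; first by ring.
  have -> : b - (a + t * (b - a)) = (1 - t) * (b - a) by ring.
  by rewrite mulr_ge0// subr_ge0.
have D0 := mdist_ge0 x y.
move: D0; rewrite le_eqVlt => /orP[/eqP/esym D0|D0].
  have /mdist_positivity -> : d c x = 0 by rewrite cx D0 mulr0.
  by have /mdist_positivity -> := D0; rewrite mdistxx; lra.
set D := d x y in cx cy D0 *; set P := d p x; set Q := d p y.
have P0 : 0 <= P := mdist_ge0 _ _.
have Q0 : 0 <= Q := mdist_ge0 _ _.
have h1 : Q <= P + D := metric_triangle _ _ _.
have h2 : P <= Q + D by rewrite /D metric_sym; exact: metric_triangle.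
have h3 : D <= P + Q by rewrite /P metric_sym; exact: metric_triangle.
(* The abscissa of the comparison point of [p], those of [x] and [y] being the origin and
   [(D, 0)]. *)
pose s := (P ^+ 2 + D ^+ 2 - Q ^+ 2) / (2 * D).
have sD : 2 * (s * D) = P ^+ 2 + D ^+ 2 - Q ^+ 2 by rewrite /s; field; rewrite gt_eqF.
have sP : s ^+ 2 <= P ^+ 2.
  have : `|s| <= P.
    by rewrite ler_norml; apply/andP; split; rewrite -(ler_pM2r D0); nra.
  by move=> h; rewrite -(real_normK (num_real s)) lerXn2r ?nnegrE// normr_ge0.
have := cat p c x y (point2 s (Num.sqrt (P ^+ 2 - s ^+ 2))) (point2 (t * D) 0)
  (point2 0 0) (point2 D 0).
have sq (u v : R) : 0 <= u -> v = u ^+ 2 -> Num.sqrt v = u.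
  by move=> u0 ->; rewrite sqrtr_sqr ger0_norm.
have S0 : Num.sqrt (P ^+ 2 - s ^+ 2) ^+ 2 = P ^+ 2 - s ^+ 2 by rewrite sqr_sqrtr// subr_ge0.
rewrite !eucl_dist_point2 !subr0 S0 expr0n /= !addr0.
rewrite (sq P)//; last by ring.
rewrite (sq Q)//; last by nra.
rewrite (sq (t * D)) ?mulr_ge0//; last exact: ltW.
rewrite (sq ((1 - t) * D)) ?mulr_ge0//; [|by rewrite subr_ge0|exact: ltW|by ring].
rewrite sub0r sqrrN (sq D)//; last exact: ltW.
move=> /(_ erefl erefl (esym cx) (esym cy) erefl (point2 (t * D) 0)).
have seg : eucl_segment (point2 0 0) (point2 D 0) (point2 (t * D) 0).
  by exists t; [rewrite t0|apply/rowP => i; rewrite !mxE; case: eqP => _; ring].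
move=> /(_ seg); rewrite !eucl_dist_point2 !subrr subr0 expr0n /= addr0 sqrtr0 addr0 S0 => h.
have : d p c ^+ 2 <= (s - t * D) ^+ 2 + (P ^+ 2 - s ^+ 2).
  have h0 : 0 <= (s - t * D) ^+ 2 + (P ^+ 2 - s ^+ 2) by rewrite addr_ge0 ?sqr_ge0 ?subr_ge0.
  by rewrite -(sqr_sqrtr h0) lerXn2r// nnegrE ?mdist_ge0 ?sqrtr_ge0.
by nra.
Qed.

Section Minimax.
Context {I : finType}.
Implicit Types (a : I -> U) (v : I -> R) (J : {set I}).

(** Says that [tau] is the minimum of [max_i (d(a_i, _)^2 - v_i)] and that [z] attains it. *)
Definition minimax a v z (tau : R) :=
  (forall i, d (a i) z ^+ 2 - v i <= tau) /\
  (forall x, exists i, tau <= d (a i) x ^+ 2 - v i).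

Definition web a J z := forall x, exists2 i, i \in J & d (a i) z ^+ 2 <= d (a i) x ^+ 2.

Lemma closed_ball_compact x (r : R) : proper_space U -> compact [set y | d x y <= r].
Proof.
move=> prop; apply: prop.
  rewrite (_ : [set _ | _] = d x @^-1` [set s | s <= r])//.
  by apply: preimage_closed => [y _|]; [exact: mdist_continuous|exact: closed_le].
exists (r + r) => y z /= xy xz; have := metric_triangle y x z.
by rewrite (metric_sym y x); lra.
Qed.

Lemma minimax_exists (i0 : I) a v : proper_space U ->
  exists z tau, minimax a v z tau.
Proof.
move=> prop; pose F i x : R := d (a i) x ^+ 2 - v i.
pose G x : R := \big[Order.max/F i0 x]_i F i x.
have GF i x : F i x <= G x by exact: le_bigmax.
have GE x : exists i, G x <= F i x.
  apply: contrapT => /forallNP H; suff : G x < G x by rewrite ltxx.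
  by apply/bigmax_ltP; split=> [|i _]; rewrite ltNge; apply/negP; exact: H.
have Gc : continuous G.
  have Fc i : continuous (F i).
    move=> x; apply: cvgB; last exact: cvg_cst.
    by rewrite expr2; apply: cvgM; exact: mdist_continuous.
  rewrite /G; elim: (index_enum _) => [|j s IH].
    by under eq_fun do rewrite big_nil; exact: Fc.
  under eq_fun do rewrite big_cons.
  by move=> x; apply: continuous_max; [exact: Fc|exact: IH].
(* As [r >= 1], beyond distance [r] from [a i0] the function exceeds [r - v i0], hence its value at
   [a i0]; so a minimum over the ball is global. *)
pose r := Num.max 0 (G (a i0) + v i0) + 1.
have r1 : 1 <= r by rewrite lerDr le_max lexx.
have rG : G (a i0) + v i0 <= r.
  by rewrite (le_trans (_ : _ <= Num.max 0 (G (a i0) + v i0)))// ?lerDl// le_max lexx orbT.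
have K0 : [set y | d (a i0) y <= r] !=set0 by exists (a i0) => /=; rewrite mdistxx; lra.
have [z _ zmin] := compact_EVT_min K0 (@closed_ball_compact (a i0) r prop)
  (continuous_subspaceT Gc).
exists z, (G z); split=> [i|x]; first exact: GF.
have [i Gi] := GE x.
have [xr|xr] := leP (d (a i0) x) r.
  by exists i; apply: le_trans Gi; apply: zmin; rewrite inE.
exists i0; apply: (@le_trans _ _ (G (a i0))).
  by apply: zmin; rewrite inE /= mdistxx; lra.
nra.
Qed.

(** Strong convexity: some function is at least [tau] at the midpoint of [z] and [x]. *)
Lemma minimax_growth a v z tau x : convex_distance -> minimax a v z tau ->
  exists i, tau + d x z ^+ 2 / 2 <= d (a i) x ^+ 2 - v i.
Proof.
move=> cvx [Hz Hx].
have [|c Hc] := cvx z x 2^-1; first by apply/andP; split; lra.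
have [i Hi] := Hx c; exists i; have := Hz i; have := Hc (a i).
by rewrite (metric_sym z x); lra.
Qed.

(** Add the growth inequalities of the two problems, each taken at the minimum point of the
    other. *)
Lemma minimax_hoelder a v w h z z' tau tau' : convex_distance ->
  minimax a v z tau -> minimax a w z' tau' -> (forall i, `|v i - w i| <= h) ->
  d z z' ^+ 2 <= 2 * h.
Proof.
move=> cvx m m' vw.
have [i Hi] := minimax_growth z' cvx m; have [j Hj] := minimax_growth z cvx m'.
have := m'.1 i; have := m.1 j; have := vw i; have := vw j.
by rewrite !ler_norml (metric_sym z' z) in Hi * => /andP[? ?] /andP[? ?]; lra.
Qed.

Lemma minimax_web a v z tau J : minimax a v z tau ->
  (forall x, exists2 i, i \in J & tau <= d (a i) x ^+ 2 - v i) -> web a J z.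
Proof.
by move=> [Hz _] H x; have [i iJ h] := H x; exists i => //; have := Hz i; lra.
Qed.

Lemma minimax_active a v z tau j : convex_distance -> minimax a v z tau ->
  d (a j) z ^+ 2 - v j < tau ->
  forall x, exists2 i, i \in [set~ j]%SET & tau <= d (a i) x ^+ 2 - v i.
Proof.
move=> cvx [Hz Hx] jt y; apply: contrapT => Hy.
set A := d (a j) z ^+ 2 - v j in jt; pose B := d (a j) y ^+ 2 - v j.
(* So small that the function [j], rising by at most [t * (B - A)], stays below [tau]. *)
pose t := (tau - A) / (tau - A + `|B - A|).
have N0 := normr_ge0 (B - A).
have D0 : 0 < tau - A + `|B - A| by lra.
have tD : t * (tau - A + `|B - A|) = tau - A by rewrite divfK// gt_eqF.
have t0 : 0 < t by rewrite divr_gt0//; lra.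
have t1 : t <= 1 by rewrite ler_pdivrMr// mul1r; lra.
have [|c Hc] := cvx z y t; first by rewrite t1 ltW.
have sq : 0 <= t * (1 - t) * d z y ^+ 2.
  by rewrite mulr_ge0 ?sqr_ge0// mulr_ge0 ?subr_ge0// ltW.
have [i] := Hx c; have := Hc (a i).
have [->|ij] := eqVneq i j.
  have : t * (B - A) <= t * `|B - A| by rewrite ler_wpM2l ?ler_norm// ltW.
  have : 0 < t * (tau - A) by rewrite mulr_gt0// subr_gt0.
  by move: tD; rewrite /B /A; lra.
have : d (a i) y ^+ 2 - v i < tau.
  by rewrite ltNge; apply/negP => h; apply: Hy; exists i => //; rewrite !inE.
rewrite -(ltr_pM2l t0) => h.
have : (1 - t) * (d (a i) z ^+ 2 - v i) <= (1 - t) * tau.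
  by rewrite ler_wpM2l// subr_ge0.
by lra.
Qed.

(** Apply the web property at the midpoint of [p] and [q]. Thus differences of squared distances
    serve as coordinates on a web. *)
Lemma web_separation a J p q : convex_distance -> web a J p ->
  exists2 i, i \in J & d p q ^+ 2 / 2 <= d (a i) q ^+ 2 - d (a i) p ^+ 2.
Proof.
move=> cvx W; have [|c Hc] := cvx p q 2^-1; first by apply/andP; split; lra.
by have [i iJ h] := W c; exists i => //; have := Hc (a i); lra.
Qed.

(* [web a J] lies in the closed convex hull of the [a i], [i \in J]. *)
Lemma web_hull a J z b (s : R) : convex_distance -> web a J z ->
  (forall i, i \in J -> d b (a i) <= s) -> d b z <= s.
Proof.
move=> cvx W bs; rewrite leNgt; apply/negP => sz.
have s0 : 0 <= s.
  by have [i /bs h _] := W z; exact: le_trans (mdist_ge0 _ _) h.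
set D := d b z in sz; have D0 : 0 < D by lra.
have D2 : s ^+ 2 < D ^+ 2 by rewrite ltrXn2r ?nnegrE// ltW.
(* With this [t], [(1 - t) * D ^+ 2] is the mean of [s ^+ 2] and [D ^+ 2], hence exceeds [s ^+ 2]:
   moving from [z] towards [b] gets closer to every [a i]. *)
pose t := (D ^+ 2 - s ^+ 2) / (2 * D ^+ 2).
have tD : t * (2 * D ^+ 2) = D ^+ 2 - s ^+ 2.
  by rewrite divfK// mulf_neq0// expf_neq0// gt_eqF.
have DD : 0 < D ^+ 2 by rewrite exprn_gt0.
have ss := sqr_ge0 s.
have t0 : 0 < t by rewrite divr_gt0//; lra.
have t1 : t <= 1 by rewrite ler_pdivrMr; lra.
have [|c Hc] := cvx z b t; first by rewrite t1 ltW.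
have [i iJ h] := W c; have := Hc (a i); rewrite (metric_sym z b) -/D => hc.
have : d (a i) b ^+ 2 <= s ^+ 2.
  by rewrite lerXn2r ?nnegrE ?mdist_ge0// metric_sym bs.
have := sqr_ge0 (d (a i) z); nra.
Qed.

End Minimax.
End MinimaxPoints.

(** * Essential families of balls *)

Section FiniteBounds.
Context {R : realType} {I : finType}.

Lemma finite_lower_bound (F : I -> R) : (forall i, 0 < F i) ->
  exists2 rho, 0 < rho & forall i, rho <= F i.
Proof.
move=> F0; exists (\big[Order.min/1]_i F i); first by apply/bigmin_gtP.
by move=> i; have /bigmin_geP[_] := lexx (\big[Order.min/1]_i F i); apply.
Qed.

Lemma finite_upper_bound (F : I -> R) : exists M, forall i, F i <= M.
Proof. by exists (\big[Order.max/0]_i F i) => i; exact: le_bigmax. Qed.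

End FiniteBounds.

Section EuclideanDistance.
Context {R : realType} {n : nat}.
Implicit Types x y : 'rV[R]_n.

Lemma le_eucl_dist x y i : `|x ord0 i - y ord0 i| <= eucl_dist x y.
Proof.
rewrite /eucl_dist -sqrtr_sqr ler_wsqrtr// (bigD1 i)//= lerDl.
by apply: sumr_ge0 => j _; exact: sqr_ge0.
Qed.

Lemma eucl_dist_le x y (c : R) : 0 <= c -> (forall i, `|x ord0 i - y ord0 i| <= c) ->
  eucl_dist x y <= n%:R * c.
Proof.
move=> c0 xy; rewrite -[leRHS]ger0_norm ?mulr_ge0// -sqrtr_sqr ler_wsqrtr//.
apply: (@le_trans _ _ (\sum_(i < n) c ^+ 2)).
  apply: ler_sum => i _; rewrite -(real_normK (num_real (_ - _))).
  by rewrite lerXn2r ?nnegrE.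
rewrite sumr_const card_ord -[leLHS]mulr_natl exprMn; apply: ler_wpM2r; first exact: sqr_ge0.
by rewrite -natrX ler_nat; case: (n) => // k; rewrite expnS leq_pmulr.
Qed.

End EuclideanDistance.

Section BallConfigurations.
Context {R : realType} {U : metricType R}.
Local Notation d := (@mdist R U).

Definition essential_balls m (a : 'I_m.+1 -> U) (r : 'I_m.+1 -> R) :=
  [/\ forall i, 0 <= r i,
      \bigcap_i ball (a i) (r i) = set0
    & forall j, \bigcap_(i in [set i | i != j]) ball (a i) (r i) !=set0].

Lemma essential_ballsP m (a : 'I_m.+1 -> U) (r : 'I_m.+1 -> R) :
  essential_balls a r <->
  [/\ forall i, 0 <= r i,
      forall x, exists i, r i <= d (a i) x
    & forall j, exists p, forall i, i != j -> d (a i) p < r i].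
Proof.
split=> [[r0 E0 E]|[r0 E0 E]]; split=> //.
- move=> x; apply: contrapT => /forallNP H; suff : (set0 : set U) x by [].
  by rewrite -E0 => i _; rewrite ballE ltNge; apply/negP; exact: H.
- by move=> j; have [p Hp] := E j; exists p => i ij; rewrite -ballE; exact: Hp.
- rewrite -subset0 => x Hx; have [i] := E0 x; have /ballE := Hx i I.
  by rewrite ltNge => /negP.
- by move=> j; have [p Hp] := E j; exists p => i /= ij; rewrite ballE; exact: Hp.
Qed.

Definition essential_dim m :=
  exists (a : 'I_m.+1 -> U) (r : 'I_m.+1 -> R), essential_balls a r.

Lemma essential_dim0 : [set: U] !=set0 -> essential_dim 0.
Proof.
(* A ball of radius 0 is empty, and the intersection over no index is the whole space. *)
move=> [x _]; exists (fun=> x), (fun=> 0); apply/essential_ballsP; split=> //.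
  by move=> y; exists ord0; exact: mdist_ge0.
by move=> j; exists x => i; rewrite !ord1.
Qed.

(** An inclusion-minimal subfamily with empty intersection is essential, so it has at most [m]
    members. *)
Lemma essential_subfamily m {I : finType} (a : I -> U) (r : I -> R) :
  (forall k, (m <= k)%N -> ~ essential_dim k) -> (forall i, 0 <= r i) ->
  (forall x, exists i, r i <= d (a i) x) ->
  exists2 J : {set I}, (#|J| <= m)%N & forall x, exists2 i, i \in J & r i <= d (a i) x.
Proof.
move=> Hm r0 Hx.
pose P (J : {set I}) := `[< forall x, exists2 i, i \in J & r i <= d (a i) x >].
have PT : P [set: I]%SET by apply/asboolP => x; have [i] := Hx x; exists i.
have [J minJ _] := minset_exists PT.
have /asboolP PJ := minsetp minJ.
exists J => //; rewrite leqNgt; apply/negP => mJ.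
have [k Ek] : exists k, #|J| = k.+1 by case: #|J| mJ => // k; exists k.
apply: (Hm k); first by rewrite -ltnS -Ek.
pose e (i : 'I_k.+1) : I := enum_val (cast_ord (esym Ek) i).
exists (a \o e), (r \o e); apply/essential_ballsP; split=> [i|x|j] /=.
- exact: r0.
- have [i iJ h] := PJ x; exists (cast_ord Ek (enum_rank_in iJ i)).
  by rewrite /e cast_ordK enum_rankK_in.
have eJ i : e i \in J by exact: enum_valP.
have /asboolPn H : ~~ P (J :\ e j)%SET.
  apply/negP => H; have /setP/(_ (e j)) := minsetinf minJ H (subsetDl _ _).
  by rewrite !inE eqxx eJ.
have {H} [x Hxj] : exists x, ~ exists2 i, i \in (J :\ e j)%SET & r i <= d (a i) x.
  by apply/existsNP.
exists x => i ij; rewrite ltNge; apply/negP => h; apply: Hxj; exists (e i) => //.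
by rewrite in_setD1 eJ andbT; apply: contra ij => /eqP/enum_val_inj/cast_ord_inj ->.
Qed.

(** Translates weights into radii: the open balls of radius [Num.sqrt (v i + tau)] have empty
    intersection because [tau] is the minimum. *)
Lemma minimax_radius {I : finType} (a : I -> U) (v : I -> R) z tau i x :
  minimax a v z tau ->
  (Num.sqrt (v i + tau) <= d (a i) x) = (tau <= d (a i) x ^+ 2 - v i).
Proof.
move=> [/(_ i) Hz _]; have h : 0 <= v i + tau by have := sqr_ge0 (d (a i) z); lra.
by rewrite -(ger0_norm (mdist_ge0 (a i) x)) -sqrtr_sqr ler_sqrt ?sqr_ge0//
  sqrtr_sqr ger0_norm ?mdist_ge0// lerBrDl.
Qed.

Lemma weighted_subfamily m {I : finType} (a : I -> U) (v : I -> R) z tau :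
  (forall k, (m <= k)%N -> ~ essential_dim k) -> minimax a v z tau ->
  exists2 J : {set I}, (#|J| <= m)%N & web a J z.
Proof.
move=> Hm zP; have [_ Hx] := zP.
have E := minimax_radius _ _ zP.
have [i||J Jm HJ] := essential_subfamily Hm (a := a) (r := fun i => Num.sqrt (v i + tau)).
- exact: sqrtr_ge0.
- by move=> x; have [i] := Hx x; exists i; rewrite E.
exists J => //; apply: (minimax_web zP) => x.
by have [i iJ] := HJ x; rewrite E; exists i.
Qed.

Lemma weighted_essential k (a : 'I_k.+1 -> U) (v : 'I_k.+1 -> R) z tau :
  ~ essential_dim k -> minimax a v z tau -> exists j, web a [set~ j]%SET z.
Proof.
move=> Hk zP; have [_ Hx] := zP; apply: contrapT => /forallNP H; apply: Hk.
have E := minimax_radius _ _ zP.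
exists a, (fun i => Num.sqrt (v i + tau)); apply/essential_ballsP; split=> [i|x|j].
- exact: sqrtr_ge0.
- by have [i] := Hx x; exists i; rewrite E.
apply: contrapT => /forallNP Hp; apply: (H j); apply: (minimax_web zP) => x.
have /existsNP[i /not_implyP[ij h]] := Hp x.
by exists i; [rewrite !inE|rewrite -E leNgt; apply/negP].
Qed.

Hypotheses (prop : proper_space U) (cvx : @convex_distance R U).

(* The points [p_j] missing only the ball [j], for [j <= k], all lie in the ball [k + 1].
   If no [k + 1] balls were essential, the minimizers of [max_j (d(p_j, _)^2 - v_j)] would all
   lie in the union of the balls [0 ... k], and colouring a fine grid of weights [v] according
   to these balls would produce a point in all of them. *)
Lemma essential_dimS k : [set: U] !=set0 -> essential_dim k.+1 -> essential_dim k.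
Proof.
move=> U0 [a [r /essential_ballsP[r0 E0 E]]]; apply: contrapT => Hk.
have [p Hp] := choice E.
pose w := widen_ord (leqnSn k.+1) : 'I_k.+1 -> 'I_k.+2.
have w_max i : w i != ord_max by rewrite -val_eqE /= ltn_eqF.
have w_inj i j : (w i == w j) = (i == j) by [].
pose q := p \o w : 'I_k.+1 -> U.
pose F (ij : 'I_k.+2 * 'I_k.+2) := if ij.1 == ij.2 then 1 else r ij.1 - d (a ij.1) (p ij.2).
have [ij|rho rho0 rhoP] := @finite_lower_bound R _ F.
  by rewrite /F; case: ifPn => // /Hp; rewrite subr_gt0.
have {}rhoP i j : i != j -> d (a i) (p j) <= r i - rho.
  by move=> ij; have := rhoP (i, j); rewrite /F /= (negbTE ij); lra.
have [D Dq] := @finite_upper_bound R ('I_k.+1 * 'I_k.+1)%type (fun ij => d (q ij.1) (q ij.2)).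
have D0 : 0 <= D by have := Dq (ord0, ord0); rewrite /= mdistxx.
pose M := D ^+ 2 + 1.
have M0 : 0 < M by rewrite ltr_wpDl ?sqr_ge0.
(* Neighbouring grid points will have weights within [2 * M / N], so by [minimax_hoelder] their
   minimum points are closer than [rho]. *)
have [N N0 HN] : exists2 N, (0 < N)%N & 4 * M / N%:R < rho ^+ 2.
  have X0 : 0 <= 4 * M / rho ^+ 2 by rewrite divr_ge0 ?sqr_ge0// mulr_ge0// ltW.
  have NX := archi_boundP X0; set N := Num.bound _ in NX.
  have N0 : (0 < N)%N by rewrite -(ltr_nat R); exact: le_lt_trans NX.
  by exists N => //; rewrite ltr_pdivrMr ?ltr0n// [ltRHS]mulrC -ltr_pdivrMr ?exprn_gt0.
(* Since [M] exceeds all squared distances involved, [x i = 0] makes the index [i] inactive and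
   [x i = N] makes the last index inactive. *)
pose v (x : {ffun 'I_k -> 'I_N.+1}) (i : 'I_k.+1) : R :=
  if unlift ord_max i is Some j then M * (1 - 2 * (x j)%:R / N%:R) else 0.
have /choice[Z HZ] : forall x, exists zt : U * R, minimax q (v x) zt.1 zt.2.
  by move=> x; have [z [t zt]] := minimax_exists ord0 q (v x) prop; exists (z, t).
have Zweb x : web q [set: _]%SET (Z x).1.
  by apply: (minimax_web (HZ x)) => y; have [i] := (HZ x).2 y; exists i.
have ZD x i : d (q i) (Z x).1 ^+ 2 < M.
  rewrite /M ltr_pwDr// lerXn2r ?nnegrE ?mdist_ge0//.
  by apply: (web_hull cvx (Zweb x)) => j _; exact: (Dq (i, j)).
have inactive x i : d (q i) (Z x).1 ^+ 2 - v x i < (Z x).2 -> web q [set~ i]%SET (Z x).1.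
  by move=> h; apply: (minimax_web (HZ x)); exact: minimax_active h.
have vmax x : v x ord_max = 0 by rewrite /v unlift_none.
have vlift x i : v x (lift ord_max i) = M * (1 - 2 * (x i)%:R / N%:R) by rewrite /v liftK.
have NR : N%:R != 0 :> R by rewrite pnatr_eq0 -lt0n.
(* The colour is an index that the web can spare: the least [i] with [x i = 0]; failing that, the
   last index if some [x i = N]; otherwise one from [weighted_essential]. *)
have /choice[c Hc] : forall x, exists c : 'I_k.+1, [/\ web q [set~ c]%SET (Z x).1,
    forall i : 'I_k, x i = 0 :> nat -> (c <= i)%N
    & forall i : 'I_k, x i = N :> nat -> (c : nat) != i].
  move=> x; have [/existsP[i0 xi0]|no0] := boolP [exists i, x i == 0 :> nat].
    have [i /eqP xi imin] := arg_minnP (fun i : 'I_k => i : nat)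
      (xi0 : (fun i => x i == 0 :> nat) i0).
    exists (lift ord_max i); rewrite lift_max; split=> [|j /eqP/imin//|j xj].
      apply: inactive; have := (HZ x).1 ord_max; rewrite vmax vlift xi mulr0 mul0r.
      by have := sqr_ge0 (d (q ord_max) (Z x).1); have := ZD x (lift ord_max i); lra.
    by apply: contraTN N0 => /eqP/ord_inj ij; rewrite -xj -ij xi.
  have no0' i : x i <> 0 :> nat by move=> h; case/existsP: no0; exists i; rewrite h.
  have [/existsP[i /eqP xi]|noN] := boolP [exists i, x i == N :> nat].
    exists ord_max; split=> [|j /no0'//|j _]; last by rewrite gtn_eqF /=.
    apply: inactive; have := (HZ x).1 (lift ord_max i); rewrite vmax vlift xi mulfK//.
    by have := sqr_ge0 (d (q (lift ord_max i)) (Z x).1); have := ZD x ord_max; lra.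
  have [j Hj] := weighted_essential Hk (HZ x); exists j; split=> // [i /no0'//|i xi].
  by case/existsP: noN; exists i; rewrite xi.
have [|x i xi|x i xi||y [yc yN]] := @kuhn_rainbow k N (fun x => c x : nat).
- by move=> x; rewrite -ltnS.
- by have [_ h _] := Hc x; exact: h.
- by have [_ _ h] := Hc x; exact: h.
- exact: N0.
have near i j : d (Z (y i)).1 (Z (y j)).1 < rho.
  rewrite -(ltr_pXn2r (_ : 0 < 2)%N) ?nnegrE ?mdist_ge0// ?ltW//.
  apply: le_lt_trans HN; have -> : 4 * M / N%:R = 2 * (2 * M / N%:R) by ring.
  apply: (minimax_hoelder cvx (HZ _) (HZ _)) => l; rewrite /v.
  case: unliftP => [l' _|_]; last by rewrite subrr normr0 divr_ge0// mulr_ge0// ltW.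
  have -> : M * (1 - 2 * (y i l')%:R / N%:R) - M * (1 - 2 * (y j l')%:R / N%:R) =
      (2 * M / N%:R) * ((y j l')%:R - (y i l')%:R) by ring.
  have MN : 0 <= 2 * M / N%:R by rewrite divr_ge0// mulr_ge0// ltW.
  rewrite normrM ger0_norm// ler_piMr// ler_norml.
  have := yN i j l'; have := yN j i l'; rewrite -!(ler_nat R) -!natr1 => h1 h2.
  by apply/andP; split; lra.
(* The minimum point of colour [j] lies in the hull of the [q i] with [i != j], at depth [rho] in
   the ball [j]; so the nearby point [Z (y ord0)] is in every ball. *)
have [j] := E0 (Z (y ord0)).1; apply/negP; rewrite -ltNge.
have [->|/eqP jm] := eqVneq j ord_max.
  apply: (@le_lt_trans _ _ (r ord_max - rho)); last by lra.
  by apply: (web_hull cvx (Zweb _)) => i _; apply: rhoP; rewrite eq_sym w_max.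
have [j' ->] : exists j', j = w j'.
  have jk : (j < k.+1)%N.
    rewrite ltn_neqAle -ltnS ltn_ord andbT.
    by apply/eqP => h; apply/jm/val_inj.
  by exists (Ordinal jk); apply: val_inj.
have [h _ _] := Hc (y j').
have : d (a (w j')) (Z (y j')).1 <= r (w j') - rho.
  apply: (web_hull cvx h) => i; rewrite !inE => ij; apply: rhoP.
  by rewrite w_inj eq_sym; move: ij; rewrite (_ : c (y j') = j')//; apply: val_inj; exact: yc.
by have := near j' ord0; have := metric_triangle (a (w j')) (Z (y j')).1 (Z (y ord0)).1; lra.
Qed.

End BallConfigurations.

(** * The embedding of a set of weights given by an essential family of balls *)

Section HoelderEmbedding.
Context {R : realType} {U : metricType R}.
Local Notation d := (@mdist R U).

(* [Phi w] minimizes [max_i (d(a_i, _)^2 - r_i^2 - w_i)], with [w_0 = 0].  For small [w] all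
   the functions are active at the minimum, so that [w] is recovered from their values. *)
Lemma essential_embedding m : proper_space U -> @convex_distance R U ->
  essential_dim (U := U) m ->
  exists (V : set 'rV[R]_m) (Phi : 'rV[R]_m -> U),
    [/\ open V, V !=set0 & bihoelder_on (@eucl_dist R m) d 2^-1 V Phi].
Proof.
move=> prop cvx [a [r /essential_ballsP[r0 E0 E]]].
have [p Hp] := choice E.
pose F (ij : 'I_m.+1 * 'I_m.+1) :=
  if ij.1 == ij.2 then 1 else r ij.1 ^+ 2 - d (a ij.1) (p ij.2) ^+ 2.
have [ij|rho rho0 rhoP] := @finite_lower_bound R _ F.
  rewrite /F; case: ifPn => // /Hp; rewrite subr_gt0 => h.
  by rewrite ltrXn2r ?nnegrE// mdist_ge0.
have {}rhoP i j : i != j -> d (a i) (p j) ^+ 2 <= r i ^+ 2 - rho.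
  by move=> ij; have := rhoP (i, j); rewrite /F /= (negbTE ij); lra.
pose e := rho / 3; have e0 : 0 < e by rewrite divr_gt0.
pose w (x : 'rV[R]_m) i : R := if unlift ord0 i is Some j then x ord0 j else 0.
pose v x i := r i ^+ 2 + w x i.
have /choice[Z HZ] : forall x, exists zt : U * R, minimax a (v x) zt.1 zt.2.
  by move=> x; have [z [t zt]] := minimax_exists ord0 a (v x) prop; exists (z, t).
pose V : set 'rV[R]_m := ball (0 : 'rV[R]_m) e.
have wV x i : V x -> `|w x i| < e.
  move=> [_ Vx]; rewrite /w; case: unliftP => [j _|_]; last by rewrite normr0.
  by have := Vx ord0 j; rewrite /ball /= mxE sub0r normrN.
have active x i : V x -> d (a i) (Z x).1 ^+ 2 - v x i = (Z x).2.
  move=> Vx; apply/eqP; rewrite eq_le (HZ x).1 /= leNgt; apply/negP => h.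
  (* At [p i] all other functions are below [e - rho], hence below [- e], whereas the minimum
     exceeds [- e] because the balls have no common point. *)
  have [l] := minimax_active cvx (HZ x) h (p i); rewrite !inE => /rhoP h1.
  have [j hj] := E0 (Z x).1; have hj2 : r j ^+ 2 <= d (a j) (Z x).1 ^+ 2.
    by rewrite lerXn2r ?nnegrE ?mdist_ge0.
  have := (HZ x).1 j; have := wV x l Vx; have := wV x j Vx.
  by rewrite /v /e !ltr_norml => /andP[? ?] /andP[? ?]; lra.
pose g (y : U) : 'rV[R]_m := \row_j ((d (a (lift ord0 j)) y ^+ 2 - r (lift ord0 j) ^+ 2) -
   (d (a ord0) y ^+ 2 - r ord0 ^+ 2)).
have gK x : V x -> g (Z x).1 = x.
  move=> Vx; apply/rowP => j; rewrite mxE; have := active x ord0 Vx.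
  by have := active x (lift ord0 j) Vx; rewrite /v /w unlift_none liftK; lra.
have near x y (h : R) : (forall i, `|w x i - w y i| <= h) -> d (Z x).1 (Z y).1 ^+ 2 <= 2 * h.
  move=> xy; apply: (minimax_hoelder cvx (HZ x) (HZ y)) => i.
  by rewrite /v (_ : _ - _ = w x i - w y i)//; ring.
have eucl_ge0 x y : 0 <= @eucl_dist R m x y by exact: sqrtr_ge0.
exists V, (fun x => (Z x).1); split; first exact: ball_open.
  by exists 0; exact: ballxx.
split.
- by move=> x y /set_mem/gK {2}<- /set_mem/gK {2}<- ->.
- exists (Num.sqrt 2) => x y Vx Vy; rewrite powR12_sqrt// -sqrtrM//.
  rewrite -[leLHS]ger0_norm ?mdist_ge0// -sqrtr_sqr ler_wsqrtr//.
  apply: near => i; rewrite /w; case: unliftP => [j _|_]; first exact: le_eucl_dist.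
  by rewrite subrr normr0.
exists g => //.
have dV x y : V x -> V y -> d (Z x).1 (Z y).1 <= Num.sqrt (4 * e).
  move=> Vx Vy; rewrite -[leLHS]ger0_norm ?mdist_ge0// -sqrtr_sqr ler_wsqrtr//.
  rewrite (_ : 4 * e = 2 * (2 * e)); last by ring.
  apply: near => i; have := wV x i Vx; have := wV y i Vy.
  by rewrite ler_norml !ltr_norml => /andP[? ?] /andP[? ?]; apply/andP; split; lra.
set D := Num.sqrt (4 * e) in dV; have D0 : 0 <= D by exact: sqrtr_ge0.
have [M0 HM0] := finite_upper_bound (fun i => d (a i) (Z 0).1).
pose M := M0 + D.
have MV x i : V x -> d (a i) (Z x).1 <= M.
  move=> Vx; have := metric_triangle (a i) (Z 0).1 (Z x).1; have := HM0 i.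
  by have := dV 0 x (ballxx _ e0) Vx; rewrite /M; lra.
have M_ge0 : 0 <= M by exact: le_trans (mdist_ge0 _ _) (MV 0 ord0 (ballxx _ e0)).
have Lip x y i : V x -> V y -> `|d (a i) (Z x).1 ^+ 2 - d (a i) (Z y).1 ^+ 2| <=
    2 * M * d (Z x).1 (Z y).1.
  move=> Vx Vy; rewrite subr_sqr normrM mulrC.
  have hx := MV x i Vx; have hy := MV y i Vy.
  have := metric_triangle (a i) (Z x).1 (Z y).1.
  have := metric_triangle (a i) (Z y).1 (Z x).1.
  rewrite (metric_sym (Z y).1) => h1 h2; apply: ler_pM => //.
    rewrite ger0_norm; first by lra.
    by rewrite addr_ge0 ?mdist_ge0.
  by rewrite ler_norml; apply/andP; split; lra.
exists (m%:R * (4 * M * Num.sqrt D)) => _ _ [x Vx <-] [y Vy <-].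
rewrite powR12_sqrt ?mdist_ge0// -!mulrA.
apply: eucl_dist_le => [|j]; first by rewrite !mulr_ge0 ?sqrtr_ge0.
rewrite -sqrtrM// !mxE.
(* On a set of diameter at most [D] the Lipschitz bound for [g] implies a Hoelder bound with
   exponent one half. *)
have DD : d (Z x).1 (Z y).1 <= Num.sqrt (D * d (Z x).1 (Z y).1).
  rewrite -[leLHS]ger0_norm ?mdist_ge0// -sqrtr_sqr ler_wsqrtr// expr2.
  by rewrite ler_wpM2r ?mdist_ge0// dV.
have := Lip x y (lift ord0 j) Vx Vy; have := Lip x y ord0 Vx Vy.
have : M * d (Z x).1 (Z y).1 <= M * Num.sqrt (D * d (Z x).1 (Z y).1) by rewrite ler_wpM2l.
by rewrite !ler_norml => h /andP[? ?] /andP[? ?]; apply/andP; split; lra.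
Qed.

End HoelderEmbedding.

(** * Lower bound of the covering dimension *)

(* The library states [compact_cover] for pointed spaces only. *)
Lemma compact_finite_cover (T : topologicalType) (E : set T) : compact E -> cover_compact E.
Proof.
move=> cE; have [->|/set0P[x0 _]] := eqVneq E set0.
  by move=> I D f _ _; exists fset0.
pose T' : ptopologicalType := HB.pack_for ptopologicalType T (isPointed.Build T x0).
by move: cE; rewrite -[compact E]/((@compact T' : set (set T)) E) (compact_cover T').
Qed.

Section LebesgueNumber.
Context {R : realType} {U : metricType R}.
Local Notation d := (@mdist R U).

Lemma metric_ball_open (x : U) (r : R) : open (ball x r).
Proof.
rewrite openE => y; rewrite ballE => xy; apply/nbhs_ballP.
exists (r - d x y) => /=; first by rewrite subr_gt0.
move=> z; rewrite !ballE => yz; have := metric_triangle x y z; lra.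
Qed.

Lemma lebesgue_number (E : set U) I (D : set I) (A : I -> set U) : compact E ->
  (forall i, D i -> open (A i)) -> E `<=` \bigcup_(i in D) A i ->
  exists2 rho : R, 0 < rho & forall x, E x -> exists2 i, D i & ball x rho `<=` A i.
Proof.
move=> cE oA EA.
have /choice[e He] : forall x, exists e : R, 0 < e /\
    (E x -> exists2 i, D i & ball x (e + e) `<=` A i).
  move=> x; have [/EA[i Di Aix]|nE] := pselect (E x); last by exists 1.
  have /nbhs_ballP[e /= e0 He] : nbhs x (A i) by apply: open_nbhs_nbhs; split=> //; exact: oA.
  exists (e / 2); split; first by rewrite divr_gt0.
  by move=> _; exists i => //; rewrite -splitr.
have := @compact_finite_cover _ _ cE U E (fun x => ball x (e x)).
case=> [x _|x Ex|D' D'E ED'].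
- exact: metric_ball_open.
- by exists x => //; apply: ballxx; have [] := He x.
have [x|rho rho0 rhoP] := @finite_lower_bound R D' (fun x => e (val x)).
  by have [] := He (val x).
exists rho => // x /ED'[x' /= x'D' x'x].
have /set_mem Ex' := D'E _ x'D'.
have [_ /(_ Ex')[i Di Hi]] := He x'; exists i => // y.
have := rhoP (FSetSub x'D'); rewrite /= => rx'.
rewrite !ballE in x'x * => xy; apply: Hi; rewrite ballE.
by have := metric_triangle x' x y; lra.
Qed.

End LebesgueNumber.

Section CoveringDimensionLowerBound.
Context {R : realType} {U : metricType R}.
Local Notation d := (@mdist R U).

(* Lebesgue's covering argument: a set of a fine cover, pulled back to a cube, does not meet
   two opposite faces; colour it by the first face [x_i = 0] it meets. *)
Lemma bihoelder_covering_dim m n (V : set 'rV[R]_m) (Phi : 'rV[R]_m -> U) :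
  proper_space U -> open V -> V !=set0 ->
  bihoelder_on (@eucl_dist R m) d 2^-1 V Phi ->
  @covering_dim_at_most U n -> (m <= n)%N.
Proof.
move=> prop oV [x0 Vx0] [_ [C' HC'] [g gK [C2' HC2']]] cov.
rewrite leqNgt; apply/negP => nm.
have eucl_ge0 x y : 0 <= @eucl_dist R m x y by exact: sqrtr_ge0.
pose C := `|C'| + 1; have C0 : 0 < C by rewrite ltr_wpDl.
pose C2 := `|C2'| + 1; have C20 : 0 < C2 by rewrite ltr_wpDl.
have HC x y : V x -> V y -> d (Phi x) (Phi y) <= C * Num.sqrt (eucl_dist x y).
  move=> Vx Vy; apply: le_trans (HC' x y Vx Vy) _; rewrite powR12_sqrt//.
  by rewrite ler_wpM2r ?sqrtr_ge0// (le_trans (ler_norm _))// lerDl.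
have HC2 x y : V x -> V y -> eucl_dist x y <= C2 * Num.sqrt (d (Phi x) (Phi y)).
  move=> Vx Vy; rewrite -[in leLHS](gK x Vx) -[in leLHS](gK y Vy).
  apply: le_trans (HC2' _ _ (imageP _ Vx) (imageP _ Vy)) _.
  rewrite powR12_sqrt ?mdist_ge0//.
  by rewrite ler_wpM2r ?sqrtr_ge0// (le_trans (ler_norm _))// lerDl.
have /nbhs_ballP[e /= e0 He] : nbhs x0 V by exact: open_nbhs_nbhs (conj oV Vx0).
pose s := e / 2; have s0 : 0 < s by rewrite divr_gt0.
pose cube : set 'rV[R]_m := [set x | forall i, `|x0 ord0 i - x ord0 i| <= s].
have cubeV : cube `<=` V.
  move=> x cx; apply: He; split=> // i j; rewrite ord1 /ball /=.
  by apply: le_lt_trans (cx j) _; rewrite ltr_pdivrMr// mulr_natr mulr2n ltrDl.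
(* Then [C2 * Num.sqrt eta = s]: points of [V] whose images are less than [eta] apart are closer
   than the side of the cube. *)
pose eta := (s / C2) ^+ 2; have eta0 : 0 < eta by rewrite exprn_gt0// divr_gt0.
pose Cov : set (set U) := [set B | exists x, B = ball x (eta / 2)].
have [W [[oW UW] WC _ Word]] : exists W, [/\ open_cover W, refines W Cov, locally_finite W
                & order_at_most n W].
  apply: cov; split=> [_ [x ->]|]; first exact: metric_ball_open.
  rewrite -subTset => x _; exists (ball x (eta / 2)); first by exists x.
  by apply: ballxx; rewrite divr_gt0.
have small B x y : W B -> B (Phi x) -> B (Phi y) -> V x -> V y -> eucl_dist x y < s.
  move=> /WC[_ [z ->] Bz] /Bz; rewrite ballE => zx /Bz; rewrite ballE => zy Vx Vy.
  apply: le_lt_trans (HC2 x y Vx Vy) _; rewrite mulrC -ltr_pdivlMr//.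
  rewrite -[ltRHS]ger0_norm ?divr_ge0 ?ltW// -sqrtr_sqr ltr_sqrt// -/eta.
  by have := metric_triangle (Phi x) z (Phi y); rewrite (metric_sym _ z); lra.
pose r := C * Num.sqrt (m%:R * s).
have [] := @lebesgue_number R U [set y | d (Phi x0) y <= r] _ W id.
- exact: closed_ball_compact.
- exact: oW.
- by rewrite UW.
move=> lam lam0 Hlam.
have [N N0 HN] : exists2 N, (0 < N)%N & m%:R * (s / N%:R) < (lam / C) ^+ 2.
  have L0 : 0 < (lam / C) ^+ 2 by rewrite exprn_gt0// divr_gt0.
  have X0 : 0 <= m%:R * s / (lam / C) ^+ 2 by rewrite divr_ge0 ?sqr_ge0// mulr_ge0// ltW.
  have NX := archi_boundP X0; set N := Num.bound _ in NX.
  have N0 : (0 < N)%N by rewrite -(ltr_nat R); exact: le_lt_trans NX.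
  by exists N => //; rewrite mulrA ltr_pdivrMr ?ltr0n// [ltRHS]mulrC -ltr_pdivrMr.
have NR : 0 < N%:R :> R by rewrite ltr0n.
pose grid := {ffun 'I_m -> 'I_N.+1}.
pose pt (x : grid) : 'rV[R]_m := \row_i (x0 ord0 i + s * ((x i)%:R / N%:R)).
have pt_cube x : cube (pt x).
  move=> i; rewrite mxE opprD addNKr normrN normrM (ger0_norm (ltW s0)).
  apply: ler_piMr; first exact: ltW.
  by rewrite ger0_norm ?divr_ge0// ler_pdivrMr// mul1r ler_nat -ltnS.
have ptV x : V (pt x) by exact: cubeV.
have pt_near (x y : grid) : (forall i, x i <= (y i).+1)%N -> (forall i, y i <= (x i).+1)%N ->
    d (Phi (pt x)) (Phi (pt y)) < lam.
  move=> xy yx; apply: le_lt_trans (HC _ _ (ptV x) (ptV y)) _.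
  rewrite mulrC -ltr_pdivlMr// -[ltRHS]ger0_norm ?divr_ge0 ?ltW// -sqrtr_sqr ltr_sqrt//.
    apply: le_lt_trans HN; apply: eucl_dist_le => [|i]; first by rewrite divr_ge0 ?ltW.
    rewrite !mxE (_ : _ - _ = (s / N%:R) * ((x i)%:R - (y i)%:R)); last by ring.
    have sN : 0 <= s / N%:R by rewrite divr_ge0 ?ltW.
    rewrite normrM ger0_norm//; apply: ler_piMr => //; rewrite ler_norml.
    have := xy i; have := yx i; rewrite -!(ler_nat R) -!natr1 => h1 h2.
    by apply/andP; split; lra.
  by rewrite exprn_gt0// divr_gt0.
have /choice[beta Hbeta] : forall x, exists B, W B /\ ball (Phi (pt x)) lam `<=` B.
  move=> x; have [|B WB HB] := Hlam (Phi (pt x)); last by exists B.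
  apply: le_trans (HC _ _ Vx0 (ptV x)) _; rewrite /r ler_pM2l// ler_wsqrtr//.
  by apply: eucl_dist_le (ltW s0) _; exact: pt_cube.
have beta_pt x : beta x (Phi (pt x)) by apply: (Hbeta x).2; exact: ballxx.
pose meets (B : set U) i := `[< exists x : grid, x i = 0 :> nat /\ B (Phi (pt x)) >].
have /choice[col Hcol] : forall B, exists c, [/\ (c <= m)%N,
    forall i : 'I_m, meets B i -> (c <= i)%N & forall i : 'I_m, c = i -> meets B i].
  move=> B; have [/existsP[i0 Bi0]|H] := boolP [exists i, meets B i].
    have [i Bi imin] := arg_minnP (fun i : 'I_m => i : nat) Bi0.
    by exists i; split=> [||j /ord_inj <-]//; exact: ltnW.
  exists m; split=> // i h; first by case/existsP: H; exists i.
  by have := ltn_ord i; rewrite -h ltnn.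
have [x|x i xi|x i xi||y [yc yN]] := @kuhn_rainbow m N (col \o beta).
- by have [] := Hcol (beta x).
- have [_ h _] := Hcol (beta x); apply: h; apply/asboolP; by exists x.
- apply/eqP => /= h; have [_ _ /(_ _ h)/asboolP[z [zi bz]]] := Hcol (beta x).
  have := small (beta x) _ _ (Hbeta x).1 (beta_pt x) bz (ptV _) (ptV _).
  apply/negP; rewrite -leNgt; apply: le_trans (le_eucl_dist _ _ i).
  rewrite !mxE xi zi mul0r mulr0 addr0 divff ?gt_eqF// mulr1 addrC addKr.
  by rewrite ger0_norm// ltW.
- exact: N0.
have nm2 : (n.+2 <= m.+1)%N by [].
have Finj : injective (beta \o y \o widen_ord nm2).
  move=> i j /= /(congr1 col) h; apply: val_inj.
  by have := yc (widen_ord nm2 i); have := yc (widen_ord nm2 j); rewrite /= h => -> /= ->.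
(* The first [n + 2] colours give distinct members of [W], all containing the image of [y ord0],
   which is within [lam] of the other images. *)
have := Word _ Finj (fun i => (Hbeta _).1); apply/eqP/set0P.
exists (Phi (pt (y ord0))) => i _ /=; apply: (Hbeta _).2; rewrite ballE.
by apply: pt_near => j; exact: yN.
Qed.

End CoveringDimensionLowerBound.

(** * Upper bound of the covering dimension *)

Section Shrinking.
Context {R : realType} {U : metricType R}.
Local Notation d := (@mdist R U).

(* Shrinkability for [m = n + 1] amounts to dimension at most [n]; shrinking an indexed
   family, instead of refining a cover, makes it stable under finite unions. *)
Definition shrinkable m (E : set U) := forall I (A : I -> set U),
  (forall i, open (A i)) -> E `<=` \bigcup_i A i ->
  exists W : I -> set U, [/\ forall i, open (W i), forall i, W i `<=` A i,
    E `<=` \bigcup_i W i &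
    forall x (F : 'I_m.+1 -> I), E x -> injective F -> ~ forall k, W (F k) x].

Lemma shrinkable0 m : shrinkable m set0.
Proof.
by move=> I A oA _; exists A; split=> // i.
Qed.

(** Shrink over [E1] leaving the sets unchanged off it, then likewise over [E2]; the second step
    only makes sets smaller, so the order over [E1] persists. *)
Lemma shrinkableU m E1 E2 : closed E1 -> closed E2 ->
  shrinkable m E1 -> shrinkable m E2 -> shrinkable m (E1 `|` E2).
Proof.
move=> c1 c2 s1 s2 I A oA EA.
have [W1 [oW1 W1A E1W1 ord1]] := s1 I A oA (fun x h => EA x (or_introl h)).
pose V i := A i `&` (~` E1 `|` W1 i).
have oV i : open (V i) by apply: openI => //; apply: openU => //; rewrite openC.
have EV : E1 `|` E2 `<=` \bigcup_i V i.
  move=> x Ex; have [E1x|nE1] := pselect (E1 x).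
    by have [i _ W1x] := E1W1 x E1x; exists i => //; split; [exact: W1A|right].
  by have [i _ Ax] := EA x Ex; exists i => //; split; [|left].
have [W2 [oW2 W2V E2W2 ord2]] := s2 I V oV (fun x h => EV x (or_intror h)).
exists (fun i => V i `&` (~` E2 `|` W2 i)); split.
- by move=> i; apply: openI => //; apply: openU => //; rewrite openC.
- by move=> i x [[]].
- move=> x Ex; have [E2x|nE2] := pselect (E2 x).
    by have [i _ W2x] := E2W2 x E2x; exists i => //; split; [exact: W2V|right].
  by have [i _ Vx] := EV x Ex; exists i => //; split; [|left].
move=> x F [E1x|E2x] Finj HF.
- by apply: (ord1 x F E1x Finj) => k; have [[_ []]] := HF k.
- by apply: (ord2 x F E2x Finj) => k; have [_ []] := HF k.
Qed.

Lemma shrinkable_bigcup m (I : eqType) (s : seq I) (E : I -> set U) :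
  (forall i, closed (E i)) -> (forall i, i \in s -> shrinkable m (E i)) ->
  closed [set x | exists2 i, i \in s & E i x] /\
  shrinkable m [set x | exists2 i, i \in s & E i x].
Proof.
move=> cE; elim: s => [|i s IH] sE.
  rewrite (_ : mkset _ = set0); last by rewrite -subset0 => x [].
  by split; [exact: closed0|exact: shrinkable0].
have [cs ss] := IH (fun j js => sE j (@mem_behead _ (i :: s) j js)).
rewrite (_ : mkset _ = E i `|` [set x | exists2 i, i \in s & E i x]).
  by split; [exact: closedU|apply: shrinkableU => //; apply: sE; exact: mem_head].
rewrite eqEsubset; split=> x /=.
  by move=> [j]; rewrite inE => /predU1P[->|js] Ej; [left|right; exists j].
by move=> [Ei|[j js Ej]]; [exists i; rewrite ?mem_head|exists j; rewrite ?inE ?js ?orbT].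
Qed.

Lemma mdist2_continuous x : continuous (fun y => d x y ^+ 2).
Proof. by move=> y; apply: (@cvgM _ _ _ _ (d x) (d x)); exact: mdist_continuous. Qed.

Section Webs.
Context {I : finType}.
Implicit Types (a : I -> U) (J : {set I}).

Lemma web_closed a J : closed (web a J).
Proof.
rewrite -openC openE => z /existsNP[x Hx].
have : \near z, forall i, (i \in J -> d (a i) x ^+ 2 < d (a i) z ^+ 2).
  apply: filter_forall => i; have [iJ|_] := boolP (i \in J); last by near=> z'.
  have zi : d (a i) x ^+ 2 < d (a i) z ^+ 2.
    by rewrite ltNge; apply/negP => h; apply: Hx; exists i.
  have : nbhs (d (a i) z ^+ 2) [set r | d (a i) x ^+ 2 < r].
    by apply: open_nbhs_nbhs; split => //; exact: open_gt.
  move=> /(@mdist2_continuous (a i)) h.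
  have {}h : nbhs z [set z' | d (a i) x ^+ 2 < d (a i) z' ^+ 2] := h.
  by apply: filterS h => z' h' _.
apply: filterS => z' Hz' W; have [i iJ] := W x.
by rewrite leNgt Hz'.
Unshelve. all: by end_near. Qed.

(** Modulo constants, the scaled squared distances to the [a i], [i] in [J], map the web to a space
    of dimension [#|J| - 1]. It is covered by the integer translates [O kap] of the set of vectors
    of oscillation below 1, at most [#|J|] of which share a point. *)
Lemma web_shrinkable m a J K : (#|J| <= m)%N -> @convex_distance R U -> compact K ->
  shrinkable m (web a J `&` K).
Proof.
move=> Jm cvx cK T A oA EA; set E := web a J `&` K.
have [->|/set0P[x0 [/(_ x0)[i0 i0J _] _]]] := eqVneq E set0.
  by apply: shrinkable0 => //.
have cE : compact E by rewrite /E setIC; apply: compact_closedI => //; exact: web_closed.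
have [|rho rho0 Hrho] := lebesgue_number cE (D := setT) (fun i _ => oA i); first exact: EA.
(* By [web_separation] in both directions, two points of [E] in one cell have squared distance below
   [2 * del]. *)
pose del := rho ^+ 2 / 2; have del0 : 0 < del by rewrite divr_gt0// exprn_gt0.
pose f i x := d (a i) x ^+ 2 / del.
(* Picks one representative of each translation modulo constants. *)
pose normal (kap : {ffun I -> int}) := kap i0 = 0 /\ forall i, i \notin J -> kap i = 0.
pose O (kap : {ffun I -> int}) := [set x | forall i, i \in J -> forall j, j \in J ->
  (f i x - (kap i)%:~R) - (f j x - (kap j)%:~R) < 1].
have oO kap : open (O kap).
  rewrite openE => z Oz.
  have : \near z, forall i, i \in J -> forall j, j \in J ->
      (f i z - (kap i)%:~R) - (f j z - (kap j)%:~R) < 1.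
    apply: filter_forall => i; have [iJ|_] := boolP (i \in J); last by near=> z'.
    suff : \near z, forall j, j \in J ->
        (f i z - (kap i)%:~R) - (f j z - (kap j)%:~R) < 1 by apply: filterS => z' h _.
    apply: filter_forall => j; have [jJ|_] := boolP (j \in J); last by near=> z'.
    have zi := Oz i iJ j jJ.
    have : nbhs ((f i z - (kap i)%:~R) - (f j z - (kap j)%:~R)) [set r : R | r < 1].
      by apply: open_nbhs_nbhs; split => //; exact: open_lt.
    have cf k : {for z, continuous (f k)}.
      by apply: cvgM; [exact: mdist2_continuous|exact: cvg_cst].
    have : {for z, continuous (fun z => (f i z - (kap i)%:~R) - (f j z - (kap j)%:~R))}.
      by apply: cvgB; (apply: cvgB; [exact: cf|exact: cvg_cst]).
    move=> h /h {}h.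
    have {}h : nbhs z [set z | (f i z - (kap i)%:~R) - (f j z - (kap j)%:~R) < 1] := h.
    by apply: filterS h => z' h' _.
  by apply: filterS.
have diamO kap x y : E x -> E y -> O kap x -> O kap y -> d x y < rho.
  move=> [Wx _] [Wy _] Ox Oy.
  have [i iJ hi] := web_separation y cvx Wx; have [j jJ hj] := web_separation x cvx Wy.
  rewrite -(ltr_pXn2r (_ : 0 < 2)%N) ?nnegrE ?mdist_ge0// ?ltW//.
  have fE k z : d (a k) z ^+ 2 = del * f k z by rewrite /f mulrC divfK// gt_eqF.
  rewrite !fE (metric_sym y x) in hi hj.
  have : del * ((f i y - f j y) + (f j x - f i x)) < del * 2.
    by rewrite ltr_pM2l//; have := Oy i iJ j jJ; have := Ox j jJ i iJ; lra.
  by rewrite {2}/del; lra.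
(* Each cell is assigned to one set of the cover containing its trace on [E]; [None] is the default
   for cells missing [E]. *)
have /choice[sel Hsel] : forall kap, exists o : option T, E `&` O kap !=set0 ->
    exists2 i, o = Some i & E `&` O kap `<=` A i.
  move=> kap; have [[x [Ex Ox]]|n] := pselect (E `&` O kap !=set0); last by exists None.
  have [i _ Hi] := Hrho x Ex; exists (Some i) => _; exists i => // y [Ey Oy].
  by apply: Hi; rewrite ballE; exact: diamO Ox Oy.
pose good i kap := normal kap /\ sel kap = Some i.
exists (fun i => A i `&` \bigcup_(kap in good i) O kap); split.
- by move=> i; apply: openI => //; apply: bigcup_open => kap _.
- by move=> i x [].
- move=> x Ex; pose kap : {ffun I -> int} := [ffun i => if i \in J
    then Num.floor (f i x) - Num.floor (f i0 x) else 0].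
  (* Up to a common constant, [f i x - kap i] is a fractional part, so the oscillation is below
     1. *)
  have Okap : O kap x.
    move=> i iJ j jJ; rewrite !ffunE iJ jJ !intrB.
    have /andP[] := floor_itv (f i x); have /andP[] := floor_itv (f j x).
    by rewrite !intrD; lra.
  have [|i si Hi] := Hsel kap; first by exists x.
  exists i => //; split; first exact: Hi.
  exists kap => //; split=> //; split; first by rewrite ffunE i0J subrr.
  by move=> j jJ; rewrite ffunE (negbTE jJ).
move=> x F Ex Finj HF.
have /choice[kap Hkap] : forall k, exists kap, good (F k) kap /\ O kap x.
  by move=> k; have [_ [kap]] := HF k; exists kap.
(* If two cells at [x] have the same minimizing index [h], each [kap j - kap h] is the integer part
   of [f j x - f h x] for both, so the cells agree. *)
have /choice[h Hh] : forall k, exists i, i \in J /\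
    forall j, j \in J -> f i x - (kap k i)%:~R <= f j x - (kap k j)%:~R.
  move=> k; have [i iJ Hi] := @arg_minP _ _ _ i0 (mem J) (fun i => f i x - (kap k i)%:~R) i0J.
  by exists i.
have : (#|J| < #|[set h k | k : 'I_m.+1]%SET|)%N.
  rewrite card_imset ?card_ord// => k l hkl; apply: Finj.
  have [[[kn0 kn] ks] kO] := Hkap k; have [[[ln0 ln] ls] lO] := Hkap l.
  have [hJ hk] := Hh k; have [_ hl] := Hh l; rewrite -hkl in hl.
  have E1 j : j \in J -> kap k j - kap k (h k) = kap l j - kap l (h k).
    move=> jJ; have := hk j jJ; have := hl j jJ; have := kO j jJ _ hJ; have := lO j jJ _ hJ.
    move=> h1 h2 h3 h4; apply/eqP; rewrite eq_le -!ltzD1 -!(ltr_int R) !intrD !mulrNz.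
    by apply/andP; split; lra.
  have : kap k = kap l.
    apply/ffunP => j; have [jJ|jJ] := boolP (j \in J); last by rewrite kn ?ln.
    by have := E1 j jJ; have := E1 i0 i0J; rewrite kn0 ln0; lia.
  by move=> e; move: ks; rewrite e ls => -[].
rewrite ltnNge => /negP; apply; apply: subset_leq_card; apply/fintype.subsetP => _ /imsetP[k _ ->].
by have [] := Hh k.
Unshelve. all: by end_near. Qed.

End Webs.
End Shrinking.

(** * From webs to compact sets, and from these to the whole space *)

Section CoveringDimensionUpperBound.
Context {R : realType} {U : metricType R}.
Local Notation d := (@mdist R U).
Hypotheses (prop : proper_space U) (cvx : @convex_distance R U).

Lemma compact_net (E : set U) (e : R) : compact E -> 0 < e ->
  exists (I : finType) (a : I -> U), forall x, E x -> exists i, d (a i) x < e.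
Proof.
move=> cE e0; have := @compact_finite_cover _ _ cE U E (fun x => ball x e).
case=> [x _|x Ex|D' _ ED'].
- exact: metric_ball_open.
- by exists x => //; exact: ballxx.
exists D', val => x /ED'[i /= iD']; rewrite ballE.
by exists (FSetSub iD').
Qed.

(* [Theta p] minimizes [max_i (d(a_i, _)^2 - d(a_i, p)^2)] for an [eps]-net [a]: it is
   [2 eps]-close to [p] and lies in a web of at most [m] of the points [a_i]. *)
Lemma compact_shrinkable m (E : set U) : (forall k, (m <= k)%N -> ~ essential_dim (U := U) k) ->
  compact E -> shrinkable m E.
Proof.
move=> Hm cE T A oA EA; have [->|/set0P[x0 Ex0]] := eqVneq E set0.
  exact: shrinkable0.
have [|rho rho0 Hrho] := lebesgue_number cE (D := setT) (fun i _ => oA i); first exact: EA.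
pose e := rho / 8; have e0 : 0 < e by rewrite divr_gt0.
have [I [a net]] := compact_net cE e0.
have [i0 _] := net x0 Ex0.
have /choice[Th HTh] : forall p, exists zt : U * R,
    minimax a (fun i => d (a i) p ^+ 2) zt.1 zt.2.
  move=> p; have [z [t zt]] := minimax_exists i0 a (fun i => d (a i) p ^+ 2) prop.
  by exists (z, t).
pose Theta p := (Th p).1.
have closeTh p : E p -> d p (Theta p) < 2 * e.
  (* At [p] all the functions vanish, so the minimum is at most 0 and [Theta p] is no farther than
     [p] from any [a i]. *)
  move=> /net[i ip]; have [Hz /(_ p)[j]] := HTh p; rewrite subrr => t0.
  have : d (a i) (Theta p) <= d (a i) p.
    rewrite -(ler_pXn2r (_ : 0 < 2)%N) ?nnegrE ?mdist_ge0//.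
    by have := Hz i; rewrite /Theta; lra.
  by have := metric_triangle p (a i) (Theta p); rewrite (metric_sym p (a i)); lra.
have cTheta : continuous Theta.
  move=> p B /nbhs_ballP[r /= r0 rB].
  have h0 : 0 < r ^+ 2 / 4 by rewrite divr_gt0// exprn_gt0.
  have H : nbhs p [set q | forall i, `|d (a i) p ^+ 2 - d (a i) q ^+ 2| <= r ^+ 2 / 4].
    apply: filter_forall => i.
    by have /cvgrPdist_le/(_ _ h0) := @mdist2_continuous _ _ (a i) p.
  apply: filterS H => q pq; apply: rB; rewrite ballE.
  rewrite -(ltr_pXn2r (_ : 0 < 2)%N) ?nnegrE ?mdist_ge0// ?ltW//.
  have := minimax_hoelder cvx (HTh p) (HTh q) pq; rewrite /Theta; lra.
pose K := Theta @` E.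
have cK : compact K by apply: continuous_compact => //; exact: continuous_subspaceT.
have clK : closed K by apply: compact_closed => //; exact: metric_hausdorff.
pose s : seq {set I} := [seq J : {set I} <- enum {: {set I}} | (#|J| <= m)%N].
pose S := [set x | exists2 J : {set I}, J \in s & (web a J `&` K) x].
have [_ sS] : closed S /\ shrinkable m S.
  apply: shrinkable_bigcup => J; first by apply: closedI => //; exact: web_closed.
  by rewrite mem_filter => /andP[Jm _]; exact: web_shrinkable.
have ST p : E p -> S (Theta p).
  move=> Ep; have [J Jm HJ] := weighted_subfamily Hm (HTh p).
  by exists J; [rewrite mem_filter Jm mem_enum|split => //; exists p].
(* [Theta] moves points of [E] by less than [rho / 4]: so the [A' i] still cover [S], and the part
   over [E] of the preimage of [A' i] lies in [A i]. The strict inequality makes [A' i] open. *)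
pose A' i := [set x | exists2 r, rho / 2 < r & ball x r `<=` A i].
have [||W' [oW' W'A' SW' ord']] := sS T A'.
- move=> i; rewrite openE => x [r rr xA]; apply/nbhs_ballP.
  exists ((r - rho / 2) / 2) => /=; first by rewrite divr_gt0// subr_gt0.
  move=> y; rewrite ballE => xy; exists (r - d x y); first by lra.
  move=> z; rewrite ballE => yz; apply: xA; rewrite ballE.
  by have := metric_triangle x y z; lra.
- move=> _ [J _ [_ [p Ep <-]]]; have [i _ Hi] := Hrho p Ep; exists i => //.
  exists (3 * rho / 4); first by lra.
  move=> y; rewrite ballE => yz; apply: Hi; rewrite ballE.
  by have := closeTh p Ep; have := metric_triangle p (Theta p) y; rewrite /e; lra.
exists (fun i => A i `&` Theta @^-1` W' i); split.
- by move=> i; apply: openI => //; apply: open_comp => // x _; exact: cTheta.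
- by move=> i x [].
- move=> p Ep; have [i _ W'p] := SW' _ (ST p Ep); exists i => //; split=> //.
  have [r rr Hr] := W'A' _ _ W'p; apply: Hr; rewrite ballE metric_sym.
  by have := closeTh p Ep; rewrite /e; lra.
by move=> p F Ep Finj HF; apply: (ord' _ F (ST p Ep) Finj) => k; have [] := HF k.
Qed.

(** A finite subcover of [E] is shrunk; over [E] the other members are discarded, and off [E]
    nothing changes. *)
Lemma shrink_on_compact m (E : set U) (I : choiceType) (A : I -> set U) :
  compact E -> shrinkable m E -> (forall i, open (A i)) -> \bigcup_i A i = setT ->
  exists V : I -> set U,
    [/\ forall i, open (V i), \bigcup_i V i = setT,
      forall i, V i `<=` A i /\ A i `\` E `<=` V i,
      forall x (F : 'I_m.+1 -> I), E x -> injective F -> ~ forall k, V (F k) x &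
      finite_set [set i | V i `&` E !=set0]].
Proof.
move=> cE sE oA AT; have clE : closed E by apply: compact_closed => //; exact: metric_hausdorff.
have [i _|x Ex|D' _ ED'] := @compact_finite_cover _ _ cE I setT A.
- exact: oA.
- by rewrite /cover AT.
pose A0 i := if i \in D' then A i else set0.
have [i|x /ED'[i /= iD' Aix]|W [oW WA EW ordW]] := sE I A0.
- by rewrite /A0; case: ifP => // _; exact: open0.
- by exists i => //; rewrite /A0 iD'.
have {}WA i x : W i x -> i \in D' /\ A i x.
  by move=> /WA; rewrite /A0; case: ifP.
have VW i x : E x -> (A i `&` (~` E `|` W i)) x -> W i x by move=> Ex [_ []].
exists (fun i => A i `&` (~` E `|` W i)); split.
- by move=> i; apply: openI => //; apply: openU => //; rewrite openC.
- rewrite -subTset => x _; have [Ex|nE] := pselect (E x).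
    by have [i _ Wx] := EW x Ex; exists i => //; split; [have [] := WA _ _ Wx|right].
  have [i _ Aix] : (\bigcup_i A i) x by rewrite AT.
  by exists i => //; split => //; left.
- by move=> i; split=> x [] // Ax nE; split=> //; left.
- by move=> x F Ex Finj HF; apply: (ordW x F Ex Finj) => k; exact: VW (HF k).
- apply: sub_finite_set (finite_fset D') => i [x [Vx Ex]] /=.
  by have [] := WA i x (VW i x Ex Vx).
Qed.

(* Shrink successively over the shells [k <= d y0 x <= k + 1]; near each point the sequence of
   covers is eventually constant. *)
Lemma covering_dim_of_shrinkable n : [set: U] !=set0 ->
  (forall E : set U, compact E -> shrinkable n.+1 E) -> @covering_dim_at_most U n.
Proof.
move=> [y0 _] sh C [oC UC].
pose shell k := [set x | k%:R <= d y0 x <= k.+1%:R].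
have cshell k : compact (shell k).
  apply: prop.
    rewrite (_ : shell k = d y0 @^-1` [set r | k%:R <= r] `&` d y0 @^-1` [set r | r <= k.+1%:R]).
      by apply: closedI; apply: preimage_closed => [y _|];
        [exact: mdist_continuous|exact: closed_ge|exact: mdist_continuous|exact: closed_le].
    by apply/seteqP; split => x /=; [move=> /andP[]|move=> [h1 h2]; apply/andP].
  exists (k.+1%:R + k.+1%:R) => x y /andP[_ x1] /andP[_ y1].
  by have := metric_triangle x y0 y; rewrite (metric_sym x y0); lra.
pose cover (A : set U -> set U) := (forall i, open (A i)) /\ \bigcup_i A i = setT.
have /choice[st Hst] : forall kA : nat * (set U -> set U), exists V, cover kA.2 ->
    [/\ cover V, forall i, V i `<=` kA.2 i /\ kA.2 i `\` shell kA.1 `<=` V i,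
      forall x (F : 'I_n.+2 -> set U), shell kA.1 x -> injective F -> ~ forall k, V (F k) x &
      finite_set [set i | V i `&` shell kA.1 !=set0]].
  move=> [k A]; have [[oA TA]|nA] := pselect (cover A); last by exists A.
  have [V [oV TV VA ordV finV]] := shrink_on_compact (cshell k) (sh _ (cshell k)) oA TA.
  by exists V.
(* The cover is indexed by all sets, those outside [C] standing for the empty set. *)
pose A0 i := if `[< C i >] then i else set0.
pose V := fix V k := if k is k'.+1 then st (k', V k') else A0.
have cV k : cover (V k).
  elim: k => [|k IH]; last by have [] := Hst (k, V k) IH.
  split=> [i|]; first by rewrite /= /A0; case: asboolP => [/oC//|_]; exact: open0.
  rewrite -subTset -UC => x [B CB Bx]; exists B => //=; by rewrite /A0 asboolT.
have HV k := Hst (k, V k) (cV k).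
have Vanti k l i : (k <= l)%N -> V l i `<=` V k i.
  move=> /subnK <-; elim: (l - k)%N => [//|j IH] x /=.
  by have [_ /(_ i)[h _] _ _] := HV (j + k)%N => /h /IH.
(* From stage [k] on, only points at distance at least [k] from [y0] are affected. *)
have Vconst k l i x : (k <= l)%N -> d y0 x < k%:R -> V k i x -> V l i x.
  move=> /subnK <- xk Vx; elim: (l - k)%N => [//|j IH].
  have [_ /(_ i)[_ h] _ _] := HV (j + k)%N; apply: h; split=> //= /andP[h _].
  have : (k%:R : R) <= (j + k)%:R by rewrite ler_nat leq_addl.
  by lra.
pose B i := \bigcap_k V k i.
have VB k i x : d y0 x < k%:R -> V k i x -> B i x.
  move=> xk Vx l _; have [lk|/ltnW kl] := leqP l k; first exact: Vanti Vx.
  exact: Vconst Vx.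
have bd x : exists k, d y0 x < k%:R.
  by exists (Num.bound (d y0 x)); apply: archi_boundP; exact: mdist_ge0.
have nbd k x : d y0 x < k%:R -> nbhs x [set y | d y0 y < k%:R].
  move=> xk; apply: open_nbhs_nbhs; split=> //.
  rewrite (_ : mkset _ = ball y0 k%:R); first exact: metric_ball_open.
  by rewrite ballEmdist.
have inshell x k : d y0 x < k%:R -> exists2 j, (j < k)%N & shell j x.
  move=> xk; have /andP[h1 h2] := truncn_itv (mdist_ge0 y0 x).
  exists (Num.truncn (d y0 x)); last by rewrite /shell /= h1 ltW.
  by rewrite -(ltr_nat R); exact: le_lt_trans xk.
have oB i : open (B i).
  rewrite openE => x Bx; have [k xk] := bd x.
  have : nbhs x (V k i) by apply: open_nbhs_nbhs; split; [exact: (cV k).1|exact: Bx].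
  by move=> h; apply: filterS (filterI h (nbd k x xk)) => y [Vy yk]; exact: VB yk Vy.
exists [set D | exists2 i, C i & D = B i]; split.
- split=> [_ [i _ ->]|]; first exact: oB.
  rewrite -subTset => x _; have [k xk] := bd x.
  have [i _ Vx] : (\bigcup_i V k i) x by rewrite (cV k).2.
  exists (B i); last exact: VB xk Vx.
  exists i => //; have : V 0%N i x by exact: Vanti Vx.
  by rewrite /= /A0; case: asboolP.
- move=> _ [i Ci ->]; exists i => // x /(_ 0%N I); rewrite /= /A0.
  by case: asboolP.
- move=> x; have [k xk] := bd x; exists [set y | d y0 y < k%:R]; first exact: nbd.
  (* The ball of radius [k] about [y0] lies in the first [k] shells, each meeting finitely many sets
     of the next stage. *)
  apply: (@sub_finite_set _ _ (B @` \bigcup_(j in `I_k) [set i | V j.+1 i `&` shell j !=set0])).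
    move=> _ [[i Ci ->] [y [By yk]]]; exists i => //.
    by have [j jk jy] := inshell y k yk; exists j => //; exists y; split=> //; exact: By.
  apply: finite_image; apply: bigcup_finite; first exact: finite_II.
  by move=> j _; have [] := HV j.
move=> F Finj HF; rewrite -subset0 => x Fx.
(* Distinct members have distinct indices, so the order bound of stage [j + 1] over the shell [j]
   applies. *)
have /choice[G HG] : forall k, exists i, F k = B i by move=> k; have [i _] := HF k; exists i.
have [k xk] := bd x; have [j jk jx] := inshell x k xk.
have [_ _ ordj _] := HV j; apply: (ordj x G jx).
  by move=> k1 k2 e; apply: Finj; rewrite !HG e.
by move=> l; have := Fx l I; rewrite HG => /(_ j.+1 I).
Qed.

End CoveringDimensionUpperBound.

Theorem theorem8p13 (R : realType) (U : metricType R) (m : nat)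
    (U_nonempty : [set: U] !=set0) (U_proper : proper_space U)
    (U_geodesic : geodesic_space U) (U_CAT0 : CAT0 U) :
  [<-> (m%:Z%:E <= topdim U)%E;
       exists (a : 'I_m.+1 -> U) (r : 'I_m.+1 -> R),
         [/\ forall i, 0 <= r i,
             \bigcap_i ball (a i) (r i) = set0
           & forall j,
               \bigcap_(i in [set i | i != j]) ball (a i) (r i) !=set0];
       exists (V : set 'rV[R]_m) (Phi : 'rV[R]_m -> U),
         [/\ open V, V !=set0
           & bihoelder_on (@eucl_dist R m) (@mdist R U) 2^-1 V Phi]].
Proof.
have cvx := CAT0_convex_distance U_geodesic U_CAT0.
split=> [dimU|]; last split=> [Um|[V [Phi [oV V0 bV]]]].
- apply: contrapT; rewrite -/(essential_dim (U := U) m) => Hm.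
  (* For [m = 0] one empty ball suffices; for [m = n + 1] the dimension would be at most [n]. *)
  case: m Hm dimU => [|n] Hn dimU; first by apply: Hn; exact: essential_dim0.
  have {}Hn k : (n.+1 <= k)%N -> ~ essential_dim (U := U) k.
    elim: k => [//|k IH]; rewrite leq_eqVlt => /predU1P[<-//|nk].
    by move=> /(essential_dimS U_proper cvx U_nonempty); exact: IH.
  have dimn : @covering_dim_at_most U n.
    apply: (covering_dim_of_shrinkable U_proper U_nonempty) => E.
    exact: compact_shrinkable.
  move: dimU; rewrite /topdim; case: pselect => [h|[]]; last by exists n; apply/asboolP.
  case: ex_minnP => k _ /(_ n (asboolT dimn)) kn; rewrite lee_fin lez_nat.
  by rewrite leqNgt ltnS kn.
- exact: essential_embedding.
- rewrite /topdim; case: pselect => [h|_]; last exact: leey.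
  case: ex_minnP => k /asboolP dimk _; rewrite lee_fin lez_nat.
  exact: (bihoelder_covering_dim U_proper oV V0 bV dimk).
Qed.
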